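(* Let $-1<\beta<1$ and $\nu>-\frac{1}{2}$. Then, for all $x\geq 0$, $$\frac{e^{-\beta x}K_{\nu+1}(x)}{x^{\nu}}\int_0^x e^{\beta t}t^{\nu}I_{\nu}(t)\,dt\leq\frac{2}{2\nu+1}.$$
   Context: Here $\nu$ and $\beta$ are real, and $I_\nu$ and $K_\nu$ denote the modified Bessel functions of the first and second kind, respectively, of order $\nu$. At $x=0$ the left-hand expression is understood as its limit as $x\downarrow 0$. *)

(* Defs.v *)
From mathcomp Require Import all_boot all_order all_algebra.
From mathcomp Require Import all_classical all_reals all_analysis.

Set Implicit Arguments.
Unset Strict Implicit.
Unset Printing Implicit Defensive.

Import Order.TTheory GRing.Theory Num.Theory.
Import numFieldNormedType.Exports.

Local Open Scope classical_set_scope.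
Local Open Scope ring_scope.

Definition cosh (R : realType) (x : R) : R := (expR x + expR (- x)) / 2.

(* Euler's integral, convergent for a > 0 only; [rgamma] covers the other a. *)
Definition gamma_integral (R : realType) (a : R) : R :=
  \int[lebesgue_measure]_(t in `]0, +oo[) (t `^ (a - 1) * expR (- t)).

(* The entire function 1/Gamma at a real argument, by
   1/Gamma(a) = a (a + 1) ... (a + n - 1) / Gamma(a + n) with n large enough
   for a + n > 0 (n = 0 when a > 0).  It vanishes at 0, -1, -2, ... *)
Definition rgamma (R : realType) (a : R) : R :=
  let n := Num.truncn (1 - a) in
  (\prod_(i < n) (a + i%:R)) / gamma_integral (a + n%:R).

(* I_nu(x) = sum_k (x / 2) ^ (nu + 2 k) / (k! Gamma(nu + k + 1)), for x > 0.
   At x = 0 with nu < 0 the value is a convention of [powR]. *)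
Definition besselI (R : realType) (nu x : R) : R :=
  limn (series (fun k : nat =>
    rgamma (nu + k%:R + 1) / k`!%:R * (x / 2) `^ (nu + (2 * k)%:R))).

(* K_nu(x) = int_0^oo exp(- x cosh t) cosh(nu t) dt, for x > 0. *)
Definition besselK (R : realType) (nu x : R) : R :=
  \int[lebesgue_measure]_(t in `[0, +oo[)
    (expR (- (x * cosh t)) * cosh (nu * t)).

(* The integral is a Lebesgue integral since its integrand is unbounded near 0
   when nu < 0.  Intended for x > 0. *)
Definition bessel_expr (R : realType) (nu beta x : R) : R :=
  expR (- (beta * x)) * besselK (nu + 1) x / x `^ nu *
  \int[lebesgue_measure]_(t in `[0, x])
    (expR (beta * t) * t `^ nu * besselI nu t).

Definition bessel_expr0 (R : realType) (nu beta x : R) : R :=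
  if x == 0 then lim (bessel_expr nu beta y @[y --> 0^'+])
  else bessel_expr nu beta x.

(* Main.v *)
Require Import Defs.
From mathcomp Require Import all_boot all_order all_algebra.
From mathcomp Require Import all_classical all_reals all_analysis.
From mathcomp Require Import measurable_realfun.
From mathcomp Require Import ring lra.

(** Write m = 2 nu + 1 > 0, I_nu(x) = (x / 2)^nu A(x) and
    I_(nu+1)(x) = (x / 2)^nu B(x).  Since A' = B and B' = A - m B / x,
      (e^(s x) x^m (A - s B))' = m e^(s x) x^(m - 1) A     for s = 1 and s = -1.
    With s = 1 this gives B <= A for x > 0.  As |beta| < 1, the factor
    e^(- beta (x - t)) lies between e^(- (x - t)) and e^(x - t), so the integral
    is squeezed:
      (A - B) / m <= 2^nu x^(-m) e^(- beta x) int_0^x e^(beta t) t^nu I_nu(t) dt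
                  <= (A + B) / m.
    The Wronskian W = x^(nu+1) (A K_(nu+1) + B K_nu) is constant; letting x go to
    0 in the bounds K_nu <= K_(nu+1) and
    x^mu K_mu(x) <= 2^(mu-1) Gamma(mu) + x^mu / (2 mu) gives W <= 2^nu.  Hence
    x^(nu+1) K_(nu+1) A <= 2^nu, and A + B <= 2 A yields the bound 2 / m.
    At 0+ we have A -> 1 / Gamma(nu+1) and B -> 0, so x^(nu+1) K_(nu+1) =
    (W - x^(nu+1) B K_nu) / A converges, and so does the whole expression. *)

Import Order.TTheory GRing.Theory Num.Theory.
Import numFieldNormedType.Exports.

Local Open Scope classical_set_scope.
Local Open Scope ring_scope.

(** * Improper integrals of derivatives *)

(** The degenerate case a = b matters: the exhausting intervals used below reduce to a single point
    at n = 0. *)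
Lemma continuous_FTC2_itvcc {R : realType} (f F : R -> R) (a b : R) : a <= b ->
  (forall t : R, a <= t <= b -> is_derive t 1 F (f t)) ->
  (forall t : R, a <= t <= b -> {for t, continuous f}) ->
  (\int[lebesgue_measure]_(t in `[a, b]) (f t)%:E = (F b - F a)%:E)%E.
Proof.
rewrite le_eqVlt => /predU1P[<- _ _|ab dF cf].
  by rewrite set_itv1 integral_set1 subrr.
have cF t : a <= t <= b -> {for t, continuous F}.
  move=> /dF[+ _] => /derivable1_diffP; exact: differentiable_continuous.
rewrite (@continuous_FTC2 _ f F)//.
- apply: continuous_in_subspaceT => t /set_mem /=.
  by rewrite in_itv/= => /cf.
- split.
  + by move=> t; rewrite in_itv/= => /andP[/ltW at_ /ltW tb]; case: (dF t); rewrite ?at_.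
  + by apply: cvg_at_right_filter; apply: cF; rewrite lexx ltW.
  + by apply: cvg_at_left_filter; apply: cF; rewrite lexx ltW.
- move=> t; rewrite in_itv/= => /andP[/ltW at_ /ltW tb].
  by rewrite derive1E; case: (dF t); rewrite ?at_.
Qed.

Lemma bigcup_itvcc_itvoc {R : realType} (x : R) : 0 < x ->
  \bigcup_n `[x / n.+1%:R, x]%classic = `]0, x]%classic.
Proof.
move=> x0; apply/seteqP; split => t /=.
  move=> [n _] /=; rewrite !in_itv/= => /andP[h tx]; rewrite tx andbT.
  by apply: lt_le_trans h; rewrite divr_gt0.
rewrite in_itv/= => /andP[t0 tx].
(* The truncation n satisfies n + 1 > x / t, hence x / (n + 1) <= t. *)
exists (Num.truncn (x / t)) => //=; rewrite in_itv/= tx andbT.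
rewrite ler_pdivrMr// mulrC -ler_pdivrMr//.
by apply: ltW; rewrite truncnS_gt.
Qed.

Lemma bigcup_itvcc_itvoy {R : realType} :
  \bigcup_n `[n.+1%:R^-1, n.+1%:R]%classic = `]0%R, +oo[%classic :> set R.
Proof.
apply/seteqP; split => t /=.
  move=> [n _] /=; rewrite !in_itv/= => /andP[h _]; rewrite andbT.
  by apply: lt_le_trans h.
rewrite in_itv/= andbT => t0.
(* Adding the two truncations makes n + 1 exceed both t and 1 / t. *)
exists (Num.truncn t + Num.truncn t^-1)%N => //=; rewrite in_itv/=.
have h1 := truncnS_gt t; have h2 := truncnS_gt t^-1.
apply/andP; split.
  rewrite invf_ple ?posrE//; apply: (le_trans (ltW h2)).
  by rewrite ler_nat ltnS leq_addl.
apply: (le_trans (ltW h1)).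
by rewrite ler_nat ltnS leq_addr.
Qed.

Lemma continuous_gt0_measurable {R : realType} (f : R -> R) (D : set R) :
  D `<=` `]0, +oo[ ->
  (forall t : R, 0 < t -> {for t, continuous f}) ->
  measurable_fun D f.
Proof.
move=> D0 cf; apply: (measurable_funS _ D0) => //.
apply: open_continuous_measurable_fun => //.
by move=> t; rewrite inE/= in_itv/= andbT => /cf.
Qed.

(** The integrand may blow up at 0. On [x / (n + 1), x] the ordinary theorem gives F x - F (x / (n +
    1)); monotone convergence over these intervals and F -> 0 at 0+ do the rest. *)
Lemma ge0_FTC2_at0 {R : realType} (f F : R -> R) (x : R) : 0 < x ->
  (forall t : R, 0 < t -> 0 <= f t) ->
  (forall t : R, 0 < t -> is_derive t 1 F (f t)) ->
  (forall t : R, 0 < t -> {for t, continuous f}) ->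
  F t @[t --> 0^'+] --> 0 ->
  (\int[lebesgue_measure]_(t in `]0%R, x]) (f t)%:E = (F x)%:E)%E.
Proof.
move=> x0 f0 dF cf F0.
have sub n : 0 < x / n.+1%:R <= x.
  by rewrite divr_gt0//= ler_pdivrMr// mulr_natr mulrS lerDl mulrn_wge0// ltW.
have pos n t : `[x / n.+1%:R, x]%classic t -> 0 < t.
  by rewrite /= in_itv/= => /andP[h _]; apply: lt_le_trans h; case/andP: (sub n).
rewrite -bigcup_itvcc_itvoc//.
have mI n : measurable_fun `[x / n.+1%:R, x] f.
  by apply: continuous_gt0_measurable => // t /pos; rewrite /= in_itv/= andbT.
have ndI : nondecreasing_seq (fun n => `[x / n.+1%:R, x]%classic).
  move=> m n mn; apply/subsetPset => t /=; rewrite !in_itv/= => /andP[h ->].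
  rewrite andbT; apply: le_trans h; rewrite ler_pM2l// lef_pV2 ?posrE//.
  by rewrite ler_nat ltnS.
have /cvg_lim <- // := @ge0_nondecreasing_set_cvg_integral _ (measurableTypeR R) R
  (fun n => `[x / n.+1%:R, x]%classic) (EFin \o f) lebesgue_measure ndI
  (fun=> measurable_itv _) (fun n => (measurable_EFinP _ _).2 (mI n))
  (fun n t h => f0 _ (pos n t h)).
apply/cvg_lim => //.
rewrite [X in X @ _ --> _](_ : _ = fun n : nat => (F x - F (x / n.+1%:R))%:E).
  apply: cvg_EFin; first exact: nearW.
  rewrite -[X in _ --> X]subr0; apply: cvgB; first exact: cvg_cst.
  apply: (cvg_at_rightP _ _ _).1 F0 _ _.
  split; first by move=> n; case/andP: (sub n).
  rewrite -[X in _ --> X](mulr0 x); apply: cvgM; first exact: cvg_cst.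
  exact: cvg_harmonic.
apply/funext => n; case/andP: (sub n) => x1 x2.
apply: continuous_FTC2_itvcc => // t /andP[h _].
- by apply: dF; apply: lt_le_trans h.
- by apply: cf; apply: lt_le_trans h.
Qed.

(** * The Gamma integral *)

(** Write a ln s = a ln (2 a) + a ln (s / (2 a)) and apply ln u <= u to u = s / (2 a); the scale 2 a
    is chosen so that the last term becomes s / 2. *)
Lemma powR_le_expR_half {R : realType} (a s : R) : 0 < a -> 0 < s ->
  s `^ a <= expR (a * ln (2 * a)) * expR (s / 2).
Proof.
move=> a0 s0; rewrite -expRD /powR gt_eqF// ler_expR.
have sa0 : 0 < s / (2 * a) by rewrite divr_gt0// mulr_gt0.
have -> : ln s = ln (2 * a) + ln (s / (2 * a)).
  rewrite -lnM ?posrE ?[0 < 2 * a]mulr_gt0//.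
  by congr (ln _); field; rewrite gt_eqF.
rewrite mulrDr lerD2l.
have -> : s / 2 = a * (s / (2 * a)) by field; rewrite gt_eqF.
by rewrite ler_pM2l// ltW// ln_sublinear.
Qed.

Lemma is_derive_expRN {R : realType} (k t : R) :
  is_derive t 1 (fun s => expR (- (k * s))) (- k * expR (- (k * t))).
Proof.
have h : is_derive t 1 (fun s : R => - (k * s)) (- k).
  apply: is_derive_eq.
  by rewrite /GRing.scale /= mulr1.
apply: (is_derive_eq (@is_derive1_comp _ expR _ t _ _ (is_derive_expR _) h)).
by rewrite mulrC.
Qed.

Lemma expRN_cvg0 {R : realType} (k : R) : 0 < k ->
  expR (- (k * t)) @[t --> +oo%R] --> (0 : R).
Proof.
move=> k0.
under eq_fun do rewrite mulrC.
apply: (@cvg_comp _ _ _ (fun t => t * k) (fun t => expR (- t)) _ (pinfty_nbhs R)).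
  by apply: gt0_cvgMly => //; exact: cvg_id.
exact: cvgr_expR.
Qed.

Lemma integral_expRN {R : realType} (k : R) : 0 < k ->
  (\int[lebesgue_measure]_(t in `[0%R, +oo[) (expR (- (k * t)))%:E = (k^-1)%:E)%E.
Proof.
move=> k0.
have dF (t : R) : is_derive t 1 (fun s => - k^-1 * expR (- (k * s))) (expR (- (k * t))).
  have h := is_derive_expRN k t.
  apply: (is_derive_eq (is_deriveZ (- k^-1) h)).
  by rewrite /GRing.scale /=; field; rewrite gt_eqF.
have ct (t : R) : {for t, continuous (fun s : R => expR (- (k * s)))}.
  by apply/differentiable_continuous/derivable1_diffP; case: (is_derive_expRN k t).
rewrite (@ge0_continuous_FTC2y _ _ (fun t => - k^-1 * expR (- (k * t))) 0 0).
- by rewrite mulr0 oppr0 expR0 mulr1 sub0e -EFinN opprK.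
- by move=> t _; exact: expR_ge0.
- by apply: continuous_in_subspaceT => t _; exact: ct.
- rewrite -[X in _ --> X](mulr0 (- k^-1)); apply: cvgM; first exact: cvg_cst.
  exact: expRN_cvg0.
- by move=> t _; case: (dF t).
- by apply: cvg_at_right_filter; apply: cvgM; [exact: cvg_cst|exact: (ct 0)].
- by move=> t _; rewrite derive1E; case: (dF t).
Qed.

Lemma integrable_expRN {R : realType} (k : R) : 0 < k ->
  lebesgue_measure.-integrable `[0%R, +oo[ (fun t => (expR (- (k * t)))%:E).
Proof.
move=> k0; apply/integrableP; split.
  apply/measurable_EFinP; apply: measurable_funTS.
  apply: continuous_measurable_fun => t.
  by apply/differentiable_continuous/derivable1_diffP; case: (is_derive_expRN k t).
under eq_integral do rewrite gee0_abs ?lee_fin ?expR_ge0//.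
by rewrite integral_expRN// ltry.
Qed.

Definition gamma_integrand {R : realType} (a t : R) : R :=
  t `^ (a - 1) * expR (- t).

Lemma gamma_integrand_ge0 {R : realType} (a t : R) : 0 <= gamma_integrand a t.
Proof. by rewrite mulr_ge0 ?powR_ge0 ?expR_ge0. Qed.

Lemma continuous_powR_gt0 {R : realType} (a t : R) : 0 < t ->
  {for t, continuous (fun s : R => s `^ a)}.
Proof.
move=> t0; apply/differentiable_continuous/derivable1_diffP.
by have [] := is_derive1_powR a t0.
Qed.

Lemma gamma_integrand_continuous {R : realType} (a t : R) : 0 < t ->
  {for t, continuous (gamma_integrand a)}.
Proof.
move=> t0; apply: cvgM; first exact: continuous_powR_gt0.
by apply: continuous_comp; [exact: continuousN|exact: continuous_expR].
Qed.

(** Half of the decay of e^(- t) absorbs the power, the other half keeps the majorant integrable. *)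
Lemma gamma_integrand_le {R : realType} (a t : R) : 1 < a -> 0 < t ->
  gamma_integrand a t <=
  expR ((a - 1) * ln (2 * (a - 1))) * expR (- (2^-1 * t)).
Proof.
move=> a1 t0.
have a10 : 0 < a - 1 by rewrite subr_gt0.
have -> : expR (- (2^-1 * t)) = expR (t / 2) * expR (- t).
  by rewrite -expRD; congr expR; field.
by rewrite mulrA ler_pM2r ?expR_gt0// powR_le_expR_half.
Qed.

(** Integration by parts on [1 / (n + 1), n + 1], then monotone convergence. Equality in the
    extended reals makes it available before integrability, which is deduced from it. *)
Lemma integral_gamma_integrandD1 {R : realType} (a : R) : 0 < a ->
  (\int[lebesgue_measure]_(t in `]0%R, +oo[) (gamma_integrand (a + 1) t)%:E =
   a%:E * \int[lebesgue_measure]_(t in `]0%R, +oo[) (gamma_integrand a t)%:E)%E.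
Proof.
move=> a0.
pose I n : set R := `[n.+1%:R^-1, n.+1%:R]%classic.
have Igt0 n t : I n t -> 0 < t.
  by rewrite /I /= in_itv/= => /andP[h _]; apply: lt_le_trans h.
have ndI : nondecreasing_seq I.
  move=> m n mn; apply/subsetPset => t; rewrite /I /= !in_itv/= => /andP[h1 h2].
  apply/andP; split.
    by apply: le_trans h1; rewrite lef_pV2 ?posrE// ler_nat ltnS.
  by apply: (le_trans h2); rewrite ler_nat ltnS.
have mI b n : measurable_fun (I n) (gamma_integrand b : R -> R).
  apply: continuous_gt0_measurable => [t /Igt0|t t0].
    by rewrite /= in_itv/= andbT.
  exact: gamma_integrand_continuous.
have cvI b : (\int[lebesgue_measure]_(t in I n) (gamma_integrand b t)%:E @[n --> \oo] -->
    \int[lebesgue_measure]_(t in `]0%R, +oo[) (gamma_integrand b t)%:E)%E.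
  rewrite -bigcup_itvcc_itvoy.
  exact: (@ge0_nondecreasing_set_cvg_integral _ (measurableTypeR R) R
    I (EFin \o gamma_integrand b) lebesgue_measure ndI
    (fun=> measurable_itv _) (fun n => (measurable_EFinP _ _).2 (mI b n))
    (fun n t h => gamma_integrand_ge0 b t)).
(* The boundary term of the integration by parts; it tends to 0 at both ends. *)
pose F (t : R) := t `^ a * expR (- t).
have dF (t : R) : 0 < t ->
    is_derive t 1 F (a * gamma_integrand a t - gamma_integrand (a + 1) t).
  move=> t0.
  have h1 := is_derive1_powR a t0.
  have h2 : is_derive t 1 (fun s : R => expR (- s)) (- expR (- t)).
    have := is_derive_expRN 1 t; rewrite mulN1r mul1r => h.
    rewrite (_ : (fun s => _) = (fun s => expR (- (1 * s))))//.
    by apply/funext => s; rewrite mul1r.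
  apply: (is_derive_eq (is_deriveM h1 h2)).
  rewrite /GRing.scale /= /gamma_integrand addrK; ring.
have FTC n : (a%:E * \int[lebesgue_measure]_(t in I n) (gamma_integrand a t)%:E =
    \int[lebesgue_measure]_(t in I n) (gamma_integrand (a + 1) t)%:E +
    (F n.+1%:R - F n.+1%:R^-1)%:E)%E.
  have le1 : n.+1%:R^-1 <= n.+1%:R :> R.
    by apply: (@le_trans _ _ 1); rewrite ?invf_le1// ler1n.
  have intI b : lebesgue_measure.-integrable (I n) (EFin \o gamma_integrand b).
    apply: continuous_compact_integrable; first exact: segment_compact.
    apply: continuous_in_subspaceT => t /set_mem /Igt0; exact: gamma_integrand_continuous.
  rewrite -integralZl//; [|exact: measurable_itv|exact: intI].
  have -> : (F n.+1%:R - F n.+1%:R^-1)%:E = (\int[lebesgue_measure]_(t in I n)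
      (a * gamma_integrand a t - gamma_integrand (a + 1) t)%:E)%E.
    apply/esym; apply: continuous_FTC2_itvcc => // t /andP[t1 _].
      by apply: dF; apply: lt_le_trans t1.
    have t0 : 0 < t by apply: lt_le_trans t1.
    apply: cvgB; last exact: gamma_integrand_continuous.
    by apply: cvgM; [exact: cvg_cst|exact: gamma_integrand_continuous].
  under [X in (_ = _ + X)%E]eq_integral do rewrite EFinB EFinM.
  rewrite integralB//; [|exact: measurable_itv| |exact: intI]; last first.
    by apply: integrableZl; [exact: measurable_itv|exact: intI].
  have hB : (\int[lebesgue_measure]_(t in I n)
      (gamma_integrand (a + 1) t)%:E)%E \is a fin_num.
    by apply: integrable_fin_num; [exact: measurable_itv|exact: intI].
  exact: (esym (etrans (addeC _ _) (subeK _ hB))).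
(* F is the integrand at a + 1 > 1, so its exponential majorant applies. *)
have Fy : F n.+1%:R @[n --> \oo] --> 0.
  apply: (@squeeze_cvgr _ _ _ _ (cst 0)
    (fun n => expR (a * ln (2 * a)) * expR (- (2^-1 * n.+1%:R)))).
  - apply: nearW => n; rewrite mulr_ge0 ?powR_ge0 ?expR_ge0//=.
    have := @gamma_integrand_le _ (a + 1) n.+1%:R; rewrite /gamma_integrand addrK.
    apply => //.
    by rewrite ltrDr.
  - exact: cvg_cst.
  - rewrite -[X in _ --> X](mulr0 (expR (a * ln (2 * a)))).
    apply: cvgM; first exact: cvg_cst.
    have h : (n.+1%:R : R) @[n --> \oo] --> +oo%R.
      rewrite (@cvg_shiftS _ (fun n : nat => n%:R : R)); exact: cvgr_idn.
    have k0 : 0 < 2^-1 :> R by [].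
    exact: (cvg_comp _ (fun t : R => expR (- (2^-1 * t))) h (expRN_cvg0 _ k0)).
have F0 : F n.+1%:R^-1 @[n --> \oo] --> 0.
  have h0 : F t @[t --> 0^'+] --> 0.
    rewrite -[X in _ --> X](mul0r (expR (- 0))); apply: cvgM; first exact: powR_cvg0.
    apply: cvg_at_right_filter.
    by apply: continuous_comp; [exact: continuousN|exact: continuous_expR].
  apply: (cvg_at_rightP _ _ _).1 h0 _ _; split => //.
  exact: cvg_harmonic.
apply: (@cvg_unique _ _ _ _ _ _ (cvI (a + 1))).
  exact: ereal_hausdorff.
rewrite /= -[X in _ --> X]sube0.
rewrite (_ : (fun n => _) = (fun n =>
   a%:E * \int[lebesgue_measure]_(t in I n) (gamma_integrand a t)%:E
   - (F n.+1%:R - F n.+1%:R^-1)%:E)%E); last first.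
  by apply/funext => n; rewrite FTC addeK.
apply: cvgeB => //.
(* The difference is well defined even if the integral is infinite, since the boundary term is
   finite. *)
- by rewrite fin_num_adde_defl.
- by apply: cvgeZl.
- apply: cvg_EFin; first exact: nearW.
  by rewrite -[X in _ --> X](subr0 0); apply: cvgB.
Qed.

(** The exponential majorant does not cover the singularity at 0 when a < 1. It does give a finite
    integral at a + 1, and the functional equation with a > 0 carries finiteness back to a. *)
Lemma integrable_gamma_integrand {R : realType} (a : R) : 0 < a ->
  lebesgue_measure.-integrable `]0%R, +oo[ (fun t => (gamma_integrand a t)%:E).
Proof.
move=> a0.
have mg (b : R) : measurable_fun (`]0, +oo[%classic : set R) (EFin \o gamma_integrand b).
  apply/measurable_EFinP.
  by apply: continuous_gt0_measurable => // t; exact: gamma_integrand_continuous.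
have fin : (\int[lebesgue_measure]_(t in `]0%R, +oo[)
    (gamma_integrand (a + 1) t)%:E < +oo)%E.
  set C := expR (a * ln (2 * a)).
  apply: (@le_lt_trans _ _ (C%:E *
    \int[lebesgue_measure]_(t in `[0%R, +oo[) (expR (- (2^-1 * t)))%:E)%E);
    last by rewrite integral_expRN// -EFinM ltry.
  have k0 : 0 < 2^-1 :> R by [].
  have mE : measurable_fun (`]0, +oo[%classic : set R)
      (EFin \o (fun t : R => expR (- (2^-1 * t)))).
    have /measurable_int := integrable_expRN _ k0.
    by apply: measurable_funS => // t; rewrite /= !in_itv/= !andbT => /ltW.
  rewrite -integral_itv_obnd_cbnd// -ge0_integralZl ?lee_fin ?expR_ge0//.
  apply: ge0_le_integral => //=.
  - by move=> t _; rewrite lee_fin gamma_integrand_ge0.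
  - exact: mg.
  - by apply: (measurable_funeM C%:E mE).
  - move=> t; rewrite in_itv/= andbT => t0; rewrite -EFinM lee_fin.
    have := @gamma_integrand_le _ (a + 1) t; rewrite addrK; apply => //.
    by rewrite ltrDr.
apply/integrableP; split; first exact: mg.
under eq_integral do rewrite gee0_abs ?lee_fin ?gamma_integrand_ge0//.
move: fin; rewrite integral_gamma_integrandD1//.
set I := (\int[_]_(_ in _) _)%E.
have : (0 <= I)%E by apply: integral_ge0 => t _; rewrite lee_fin gamma_integrand_ge0.
case: I => [r _ _| _|//]; first exact: ltry.
(* An infinite integral at a would make a times it, the integral at a + 1, infinite. *)
by rewrite gt0_muley ?lte_fin.
Qed.

Lemma gamma_integralD1 {R : realType} (a : R) : 0 < a ->
  gamma_integral (a + 1) = a * gamma_integral a.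
Proof.
move=> a0; rewrite /gamma_integral /Rintegral.
rewrite [X in fine X](integral_gamma_integrandD1 _ a0).
rewrite fineM//; apply: integrable_fin_num => //.
exact: integrable_gamma_integrand.
Qed.

(** On ]0, 1] one has e^(- t) >= e^(-1), and t^(a - 1) integrates to 1 / a there, whence the lower
    bound e^(-1) / a. *)
Lemma gamma_integral_gt0 {R : realType} (a : R) : 0 < a -> 0 < gamma_integral a.
Proof.
move=> a0.
have c0 : 0 < expR (-1) / a :> R by rewrite divr_gt0// expR_gt0.
apply: (lt_le_trans c0); rewrite -lee_fin /gamma_integral /Rintegral.
rewrite fineK; last first.
  by apply: integrable_fin_num => //; exact: integrable_gamma_integrand.
pose g (t : R) := expR (-1) * t `^ (a - 1).
have cg (t : R) : 0 < t -> {for t, continuous g}.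
  by move=> t0; apply: cvgM; [exact: cvg_cst|exact: continuous_powR_gt0].
have s01 : `]0%R, 1%R]%classic `<=` (`]0%R, +oo[%classic : set R).
  by move=> t; rewrite /= !in_itv/= andbT => /andP[].
have mg (b : R) : measurable_fun (`]0, +oo[%classic : set R) (EFin \o gamma_integrand b).
  apply/measurable_EFinP.
  by apply: continuous_gt0_measurable => // t; exact: gamma_integrand_continuous.
have <- : (\int[lebesgue_measure]_(t in `]0%R, 1%R]) (g t)%:E = (expR (-1) / a)%:E)%E.
  transitivity ((expR (-1) / a * 1 `^ a)%:E); last by rewrite powR1 mulr1.
  apply: (@ge0_FTC2_at0 _ g (fun t => expR (-1) / a * t `^ a)).
  - exact: ltr01.
  - by move=> t t0; rewrite mulr_ge0 ?expR_ge0 ?powR_ge0.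
  - move=> t t0.
    apply: (is_derive_eq (is_deriveZ (expR (-1) / a) (is_derive1_powR a t0))).
    by rewrite /GRing.scale /= /g; field; rewrite gt_eqF.
  - exact: cg.
  - rewrite -[X in _ --> X](mulr0 (expR (-1) / a)); apply: cvgM; first exact: cvg_cst.
    exact: powR_cvg0.
apply: (@le_trans _ _ (\int[lebesgue_measure]_(t in `]0%R, 1%R])
  (gamma_integrand a t)%:E)%E).
  apply: ge0_le_integral => //=.
  - by move=> t _; rewrite lee_fin mulr_ge0 ?expR_ge0 ?powR_ge0.
  - by apply/measurable_EFinP; apply: continuous_gt0_measurable.
  - by apply: measurable_funS (mg a).
  - move=> t; rewrite in_itv/= => /andP[t0 t1].
    rewrite lee_fin /g /gamma_integrand mulrC ler_wpM2l ?powR_ge0//.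
    by rewrite ler_expR lerN2.
apply: ge0_subset_integral => //.
- exact: mg.
by move=> t _; rewrite lee_fin gamma_integrand_ge0.
Qed.

Lemma rgammaE {R : realType} (a : R) : 0 < a -> rgamma a = (gamma_integral a)^-1.
Proof.
move=> a0; rewrite /rgamma.
have -> : Num.truncn (1 - a) = 0%N.
  by apply/truncn0Pn; rewrite -ltNge; lra.
by rewrite big_ord0 addr0 mul1r.
Qed.

(** * The entire part of the Bessel series *)

Definition bessel_coef {R : realType} (mu : R) (k : nat) : R :=
  rgamma (mu + k%:R + 1) / k`!%:R.

(** The regularized hypergeometric function 0F1(; mu + 1; y) / Gamma(mu + 1). At y = x^2 / 4 it is
    I_mu(x) stripped of the factor (x / 2)^mu. *)
Definition bessel_entire {R : realType} (mu y : R) : R :=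
  limn (pseries (bessel_coef mu) y).

Lemma rgamma_gt0 {R : realType} (a : R) : 0 < a -> 0 < rgamma a.
Proof. by move=> a0; rewrite rgammaE// invr_gt0 gamma_integral_gt0. Qed.

Lemma rgamma_recE {R : realType} (a : R) : 0 < a -> rgamma a = a * rgamma (a + 1).
Proof.
move=> a0; rewrite !rgammaE ?ltr_wpDr// gamma_integralD1//.
by rewrite invfM mulrA divff ?mul1r// gt_eqF.
Qed.

Lemma bessel_coef_ge0 {R : realType} (mu : R) k : 0 < mu + 1 -> 0 <= bessel_coef mu k.
Proof.
move=> mu1; rewrite divr_ge0// ltW// rgamma_gt0//.
by rewrite addrAC ltr_wpDr.
Qed.

(** The recurrence 1 / Gamma(a) = a / Gamma(a + 1) at a = mu + 1 + k, with a split so that the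
    summand k yields a differentiated series. *)
Lemma bessel_coef_recE {R : realType} (mu : R) k : 0 < mu + 1 ->
  bessel_coef mu k = (mu + 1) * bessel_coef (mu + 1) k + k%:R * bessel_coef (mu + 1) k.
Proof.
move=> mu1; rewrite -mulrDl /bessel_coef rgamma_recE; last first.
  by rewrite addrAC ltr_wpDr.
by rewrite mulrA (_ : mu + k%:R + 1 = mu + 1 + k%:R)//; ring.
Qed.

(** Since (k + 1) / (k + 1)! = 1 / k!, termwise differentiation only raises the order by one. *)
Lemma pseries_diffs_bessel_coef {R : realType} (mu : R) :
  pseries_diffs (bessel_coef mu) = bessel_coef (mu + 1).
Proof.
apply/funext => k; rewrite /pseries_diffs /bessel_coef factS natrM.
have -> : mu + k.+1%:R + 1 = mu + 1 + k%:R + 1 by rewrite -natr1; ring.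
by rewrite invfM mulrCA mulVKf// pnatr_eq0.
Qed.

(** Each increment of k divides [rgamma] by mu + k + 1 >= mu + 1, which gives a geometric factor and
    a comparison with the exponential series. *)
Lemma bessel_coef_le {R : realType} (mu : R) k : 0 < mu + 1 ->
  bessel_coef mu k <= rgamma (mu + 1) * ((mu + 1)^-1 ^+ k / k`!%:R).
Proof.
move=> mu1; rewrite /bessel_coef mulrA ler_pM2r ?invr_gt0 ?ltr0n ?fact_gt0//.
elim: k => [|k IH]; first by rewrite addr0 expr0 mulr1.
rewrite exprS mulrCA -[leLHS](mulKf (lt0r_neq0 mu1)) ler_pM2l ?invr_gt0//.
apply: le_trans IH.
have h : 0 < mu + k%:R + 1 by rewrite addrAC ltr_wpDr.
rewrite (rgamma_recE _ h).
have -> : mu + k.+1%:R + 1 = mu + k%:R + 1 + 1 by rewrite -natr1; ring.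
rewrite ler_pM2r; last by rewrite rgamma_gt0// addr_gt0.
by rewrite lerD2r lerDl.
Qed.

(** At K = |y| + 1 the terms are non-negative and dominated by the exponential series at K / (mu +
    1); y lies strictly inside that radius. *)
Lemma is_cvg_bessel_pseries {R : realType} (mu y : R) : 0 < mu + 1 ->
  cvgn (pseries (bessel_coef mu) y).
Proof.
move=> mu1; apply: (@is_cvg_pseries_inside _ _ (`|y| + 1)); last first.
  by rewrite [ltRHS]ger0_norm ?addr_ge0// ltrDl.
set K := `|y| + 1; have K0 : 0 <= K by rewrite addr_ge0.
apply: (@series_le_cvg _ _
  (fun k => rgamma (mu + 1) * exp_coeff (K / (mu + 1)) k)).
- by move=> k; rewrite mulr_ge0 ?exprn_ge0 ?bessel_coef_ge0.
- move=> k; apply: mulr_ge0; first exact/ltW/rgamma_gt0.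
  by rewrite exp_coeff_ge0// divr_ge0// ltW.
- move=> k; apply: (@le_trans _ _
    (rgamma (mu + 1) * ((mu + 1)^-1 ^+ k / k`!%:R) * K ^+ k)).
    by apply: ler_wpM2r; [rewrite exprn_ge0|exact: bessel_coef_le].
  rewrite /exp_coeff /= exprMn -!mulrA le_eqVlt; apply/predU1P; left.
  by congr (_ * _); ring.
- apply: (@is_cvg_seriesZ _ _ (rgamma (mu + 1))); exact: is_cvg_series_exp_coeff.
Qed.

Lemma is_derive_bessel_entire {R : realType} (mu y : R) : 0 < mu + 1 ->
  is_derive y 1 (bessel_entire mu) (bessel_entire (mu + 1) y).
Proof.
move=> mu1.
have mu2 : 0 < mu + 1 + 1 by rewrite ltr_wpDr.
have mu3 : 0 < mu + 1 + 1 + 1 by rewrite ltr_wpDr.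
rewrite /bessel_entire -pseries_diffs_bessel_coef.
(* Termwise differentiation asks for convergence of the series and of its first two derivatives,
   that is at orders mu, mu + 1 and mu + 2. *)
apply: (@pseries_snd_diffs _ _ (`|y| + 1)); rewrite ?pseries_diffs_bessel_coef.
- exact: is_cvg_bessel_pseries.
- exact: is_cvg_bessel_pseries.
- exact: is_cvg_bessel_pseries.
- by rewrite [ltRHS]ger0_norm ?addr_ge0// ltrDl.
Qed.

(** This is I_mu - I_(mu+2) = (2 (mu + 1) / x) I_(mu+1) without the powers of x / 2, obtained by
    summing [bessel_coef_recE]. *)
Lemma bessel_entire_recE {R : realType} (mu y : R) : 0 < mu + 1 ->
  bessel_entire mu y =
  (mu + 1) * bessel_entire (mu + 1) y + y * bessel_entire (mu + 1 + 1) y.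
Proof.
move=> mu1.
have mu2 : 0 < mu + 1 + 1 by rewrite ltr_wpDr.
have mu3 : 0 < mu + 1 + 1 + 1 by rewrite ltr_wpDr.
have C1 := @is_cvg_bessel_pseries _ (mu + 1) y mu2.
have C2 := @is_cvg_bessel_pseries _ (mu + 1 + 1) y mu3.
(* At i = 0 the truncated exponent [i.-1] is harmless because the factor i vanishes. *)
have D : series (fun i => i%:R * bessel_coef (mu + 1) i * y ^+ i.-1) @ \oo -->
    bessel_entire (mu + 1 + 1) y.
  have := @pseries_diffs_equiv _ (bessel_coef (mu + 1)) y.
  by rewrite /= pseries_diffs_bessel_coef; apply.
apply/cvg_lim => //.
rewrite (_ : pseries _ _ = (fun n => (mu + 1) * pseries (bessel_coef (mu + 1)) y n +
  y * series (fun i => i%:R * bessel_coef (mu + 1) i * y ^+ i.-1) n)).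
  apply: cvgD; first by apply: cvgM; [exact: cvg_cst|exact: C1].
  by apply: cvgM; [exact: cvg_cst|exact: D].
apply/funext => n; rewrite /pseries /series /= !mulr_sumr -big_split /=.
apply: eq_bigr => -[|k] _; rewrite bessel_coef_recE//.
  by rewrite !mul0r mulr0 !addr0 mulrA.
by rewrite mulrDl exprS /=; ring.
Qed.

Lemma bessel_entire0 {R : realType} (mu : R) : bessel_entire mu 0 = rgamma (mu + 1).
Proof.
apply/cvg_lim => //.
(* The shift discards the empty partial sum; all others equal the term k = 0. *)
rewrite -(cvg_shiftS (pseries (bessel_coef mu) 0)).
rewrite (_ : (fun n => _) = fun=> rgamma (mu + 1)); first exact: cvg_cst.
apply/funext => n; rewrite /pseries /series /= big_nat_recl// big1 ?addr0.
  by rewrite expr0 mulr1 /bessel_coef addr0 divr1.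
by move=> i _; rewrite expr0n/= mulr0.
Qed.

Lemma bessel_entire_ge0 {R : realType} (mu y : R) : 0 < mu + 1 -> 0 <= y ->
  0 <= bessel_entire mu y.
Proof.
move=> mu1 y0; apply: limr_ge; first exact: is_cvg_bessel_pseries.
apply: nearW => n; apply: sumr_ge0 => k _.
by rewrite mulr_ge0 ?exprn_ge0 ?bessel_coef_ge0.
Qed.

Lemma besselIE {R : realType} (nu x : R) : 0 < nu + 1 -> 0 < x ->
  besselI nu x = (x / 2) `^ nu * bessel_entire nu (x ^+ 2 / 4).
Proof.
move=> nu1 x0; apply/cvg_lim => //.
have x20 : 0 < x / 2 by rewrite divr_gt0.
rewrite (_ : series _ = fun n => (x / 2) `^ nu * pseries (bessel_coef nu) (x ^+ 2 / 4) n).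
  by apply: cvgM; [exact: cvg_cst|exact: is_cvg_bessel_pseries].
apply/funext => n; rewrite /pseries /series /= mulr_sumr; apply: eq_bigr => k _.
rewrite powRD ?(gt_eqF x20) ?implybT// powR_mulrn ?ltW// exprM.
have -> : (x / 2) ^+ 2 = x ^+ 2 / 4 by field.
by rewrite /bessel_coef mulrCA.
Qed.

(** * The Bessel function K *)

Definition sinh {R : realType} (x : R) : R := (expR x - expR (- x)) / 2.

(** Turns the factor cosh t produced by d/dx in the integral for K into shifts of the order by 1 and
    -1. *)
Lemma cosh_mul_cosh {R : realType} (mu t : R) :
  cosh t * cosh (mu * t) = (cosh ((mu + 1) * t) + cosh ((mu - 1) * t)) / 2.
Proof.
by rewrite /cosh !mulrDl !mulNr !mul1r !opprD !opprK !expRD; field.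
Qed.

(** The counterpart for the factor sinh t produced by d/dt. *)
Lemma sinh_mul_sinh {R : realType} (mu t : R) :
  sinh t * sinh (mu * t) = (cosh ((mu + 1) * t) - cosh ((mu - 1) * t)) / 2.
Proof.
by rewrite /cosh /sinh !mulrDl !mulNr !mul1r !opprD !opprK !expRD; field.
Qed.

Lemma cosh_gt0 {R : realType} (x : R) : 0 < cosh x.
Proof. by rewrite divr_gt0// addr_gt0 ?expR_gt0. Qed.

Lemma is_derive_expRM {R : realType} (k t : R) :
  is_derive t 1 (fun s => expR (k * s)) (k * expR (k * t)).
Proof.
have := is_derive_expRN (- k) t.
rewrite (_ : (fun s => _) = (fun s => expR (k * s))); last first.
  by apply/funext => s; rewrite mulNr opprK.
by rewrite opprK mulNr opprK.
Qed.

Lemma is_derive_coshM {R : realType} (k t : R) :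
  is_derive t 1 (fun s => cosh (k * s)) (k * sinh (k * t)).
Proof.
have h := is_deriveZ 2^-1 (is_deriveD (is_derive_expRM k t) (is_derive_expRN k t)).
rewrite (_ : (fun s => _) =
  2^-1 \*: ((fun s => expR (k * s)) \+ (fun s => expR (- (k * s))))).
  by apply: (is_derive_eq h); rewrite /sinh /GRing.scale /=; field.
by apply/funext => s; rewrite /cosh /GRing.scale /= mulrC.
Qed.

Lemma is_derive_sinhM {R : realType} (k t : R) :
  is_derive t 1 (fun s => sinh (k * s)) (k * cosh (k * t)).
Proof.
have h := is_deriveZ 2^-1 (is_deriveB (is_derive_expRM k t) (is_derive_expRN k t)).
rewrite (_ : (fun s => _) =
  2^-1 \*: ((fun s => expR (k * s)) \- (fun s => expR (- (k * s))))).
  by apply: (is_derive_eq h); rewrite /cosh /GRing.scale /=; field.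
by apply/funext => s; rewrite /sinh /GRing.scale /= mulrC.
Qed.

Lemma is_derive_continuous {R : realType} (f : R -> R) (t df : R) :
  is_derive t 1 f df -> {for t, continuous f}.
Proof.
by move=> h; apply/differentiable_continuous/derivable1_diffP; case: h.
Qed.

Definition besselK_integrand {R : realType} (mu x t : R) : R :=
  expR (- (x * cosh t)) * cosh (mu * t).

Lemma besselK_integrand_ge0 {R : realType} (mu x t : R) :
  0 <= besselK_integrand mu x t.
Proof. by rewrite mulr_ge0 ?expR_ge0 ?ltW ?cosh_gt0. Qed.

Lemma is_derive_expR_cosh {R : realType} (x t : R) :
  is_derive t 1 (fun s => expR (- (x * cosh s))) (- (x * sinh t) * expR (- (x * cosh t))).
Proof.
have h := is_derive_coshM 1 t.
have {}h : is_derive t 1 (fun s => - (x * cosh s)) (- (x * sinh t)).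
  rewrite (_ : (fun s => _) = - x \*: (fun s => cosh (1 * s))); last first.
    by apply/funext => s; rewrite -mulNr -[s in LHS]mul1r.
  by apply: (is_derive_eq (is_deriveZ (- x) h)); rewrite /GRing.scale /= !mul1r mulNr.
apply: (is_derive_eq (@is_derive1_comp _ expR _ t _ _ (is_derive_expR _) h)).
by rewrite mulrC.
Qed.

Lemma besselK_integrand_continuous {R : realType} (mu x t : R) :
  {for t, continuous (besselK_integrand mu x)}.
Proof.
apply: cvgM; first exact: is_derive_continuous (is_derive_expR_cosh x t).
exact: is_derive_continuous (is_derive_coshM mu t).
Qed.

Lemma cosh_le_expR {R : realType} (M mu t : R) : `|mu| <= M -> 0 <= t ->
  cosh (mu * t) <= expR (M * t).
Proof.
move=> /ler_normlP[h1 h2] t0; rewrite /cosh ler_pdivrMr// mulr_natr mulr2n.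
apply: lerD; rewrite ler_expR; first exact: ler_wpM2r.
by rewrite -mulNr; apply: ler_wpM2r.
Qed.

(* Since [cosh t >= t ^ 2 / 4], AM-GM absorbs the linear exponent [(M + 1) t]. *)
Lemma besselK_integrand_le {R : realType} (M x0 x mu t : R) :
  0 < x0 -> x0 <= x -> `|mu| <= M -> 0 <= t ->
  besselK_integrand mu x t <= expR ((M + 1) ^+ 2 / x0) * expR (- t).
Proof.
move=> x00 x0x muM t0.
apply: (@le_trans _ _ (expR (- (x0 * (t ^+ 2 / 4))) * expR (M * t))).
  apply: ler_pM; rewrite ?expR_ge0//; last exact: cosh_le_expR.
    exact/ltW/cosh_gt0.
  rewrite ler_expR lerN2; apply: ler_pM => //; first exact: ltW.
    by rewrite divr_ge0// sqr_ge0.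
  have := expR_ge1Dxn 1 t0; rewrite /cosh.
  have := expR_ge0 (- t); rewrite (_ : 2`! = 2%N)//.
  lra.
rewrite -!expRD ler_expR -subr_ge0.
have -> : (M + 1) ^+ 2 / x0 - t - (- (x0 * (t ^+ 2 / 4)) + M * t) =
  ((M + 1) - x0 * t / 2) ^+ 2 / x0 by field; rewrite gt_eqF.
by rewrite divr_ge0 ?sqr_ge0// ltW.
Qed.

Lemma integrableMl_itv0y {R : realType} (c : R) (f : R -> R) :
  lebesgue_measure.-integrable `[0%R, +oo[ (EFin \o f) ->
  lebesgue_measure.-integrable `[0%R, +oo[ (EFin \o (fun t => c * f t)).
Proof.
move=> h; rewrite (_ : _ \o _ = (fun t => c%:E * (f t)%:E)%E)//.
by apply: integrableZl => //; exact: measurable_itv.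
Qed.

Lemma integrableB_itv0y {R : realType} (f g : R -> R) :
  lebesgue_measure.-integrable `[0%R, +oo[ (EFin \o f) ->
  lebesgue_measure.-integrable `[0%R, +oo[ (EFin \o g) ->
  lebesgue_measure.-integrable `[0%R, +oo[ (EFin \o (fun t => f t - g t)).
Proof.
move=> hf hg; rewrite (_ : _ \o _ = (fun t => (f t)%:E - (g t)%:E)%E)//.
by apply: integrableB => //; exact: measurable_itv.
Qed.

Lemma integrable_besselK_integrand {R : realType} (mu x : R) : 0 < x ->
  lebesgue_measure.-integrable `[0%R, +oo[ (fun t => (besselK_integrand mu x t)%:E).
Proof.
move=> x0.
have h1 := integrable_expRN _ (@ltr01 R).
have h := integrableMl_itv0y (expR ((`|mu| + 1) ^+ 2 / x)) _ h1.
apply: le_integrable h => //.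
  apply/measurable_EFinP; apply: measurable_funTS.
  by apply: continuous_measurable_fun => t; exact: besselK_integrand_continuous.
move=> t; rewrite /= in_itv/= andbT => t0.
rewrite lee_fin ger0_norm ?besselK_integrand_ge0// mul1r ger0_norm ?mulr_ge0 ?expR_ge0//.
exact: besselK_integrand_le.
Qed.

(** Here f may change sign. Adding C e^(- t) makes it non-negative, so the non-negative case
    applies; the added integral, equal to C, is then removed. *)
Lemma Rintegral_FTC2y_dominated {R : realType} (f F : R -> R) (C l : R) :
  (forall t : R, is_derive t 1 F (f t)) -> continuous f ->
  (forall t : R, 0 <= t -> `|f t| <= C * expR (- t)) ->
  F t @[t --> +oo%R] --> l ->
  \int[lebesgue_measure]_(t in `[0, +oo[) f t = l - F 0.
Proof.
move=> dF cf fC Fl.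
have e1 (t : R) : expR (- t) = expR (- (1 * t)) by rewrite mul1r.
have ce (t : R) : {for t, continuous (fun s : R => C * expR (- (1 * s)))}.
  apply: cvgM; first exact: cvg_cst.
  exact: is_derive_continuous (is_derive_expRN 1 t).
have iC : lebesgue_measure.-integrable `[0%R, +oo[
    (EFin \o (fun t : R => C * expR (- (1 * t)))).
  exact: (integrableMl_itv0y C _ (integrable_expRN _ (@ltr01 R))).
have if_ : lebesgue_measure.-integrable `[0%R, +oo[ (EFin \o f).
  apply: le_integrable iC => //.
    by apply/measurable_EFinP; apply: measurable_funTS; exact: continuous_measurable_fun.
  move=> t; rewrite /= in_itv/= andbT => t0; rewrite lee_fin -e1.
  by apply: (le_trans (fC _ t0)); exact: ler_norm.
have IC : \int[lebesgue_measure]_(t in `[0, +oo[) (C * expR (- (1 * t))) = C.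
  rewrite RintegralZl//; last exact: integrable_expRN.
  by rewrite /Rintegral integral_expRN// invr1 mulr1.
have dG (t : R) : is_derive t 1 (fun t => F t - C * expR (- (1 * t)))
    (f t + C * expR (- (1 * t))).
  apply: (is_derive_eq (is_deriveB (dF t) (is_deriveZ C (is_derive_expRN 1 t)))).
  by rewrite /GRing.scale /=; ring.
have : \int[lebesgue_measure]_(t in `[0, +oo[) (f t + C * expR (- (1 * t))) =
    l - (F 0 - C * expR (- (1 * 0))).
  apply: (@Rintegral_ge0_continuous_FTC2y _ _ (fun t => F t - C * expR (- (1 * t)))).
  - move=> t t0; have := fC _ t0; rewrite -e1 ler_norml => /andP[]; lra.
  - apply: continuous_in_subspaceT => t _; apply: cvgD; [exact: cf|exact: ce].
  - rewrite -[X in _ --> X]subr0 -[X in _ - X](mulr0 C).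
    apply: cvgB => //; apply: cvgM; first exact: cvg_cst.
    exact: expRN_cvg0.
  - by move=> t _; case: (dG t).
  - by apply: cvg_at_right_filter; exact: is_derive_continuous (dG 0).
  - by move=> t _; rewrite derive1E; case: (dG t).
rewrite RintegralD// IC mulr0 oppr0 expR0; lra.
Qed.

(** Integrate the t-derivative of e^(- x cosh t) sinh(mu t), which vanishes at t = 0 and at
    infinity. *)
Lemma besselK_recE {R : realType} (mu x : R) : 0 < x ->
  mu * besselK mu x = x / 2 * (besselK (mu + 1) x - besselK (mu - 1) x).
Proof.
move=> x0.
pose k := fun nu : R => besselK_integrand nu x.
have ik nu : lebesgue_measure.-integrable `[0%R, +oo[ (EFin \o k nu).
  exact: integrable_besselK_integrand.
pose f t := mu * k mu t - x / 2 * (k (mu + 1) t - k (mu - 1) t).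
(* The bound |mu| + 1 covers the three orders mu, mu + 1 and mu - 1 at once. *)
pose C := expR ((`|mu| + 1 + 1) ^+ 2 / x).
have kC nu t : `|nu| <= `|mu| + 1 -> 0 <= t -> k nu t <= C * expR (- t).
  by move=> h t0; apply: besselK_integrand_le.
have k0 nu t : 0 <= k nu t by exact: besselK_integrand_ge0.
have mu0 : `|mu| <= `|mu| + 1 by rewrite lerDl.
have mup : `|mu + 1| <= `|mu| + 1 by rewrite (le_trans (ler_normD _ _))// normr1.
have mum : `|mu - 1| <= `|mu| + 1 by rewrite (le_trans (ler_normB _ _))// normr1.
have : \int[lebesgue_measure]_(t in `[0, +oo[) f t =
    0 - expR (- (x * cosh 0)) * sinh (mu * 0).
  apply: (@Rintegral_FTC2y_dominated _ f
    (fun t => expR (- (x * cosh t)) * sinh (mu * t)) ((`|mu| + x) * C)).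
  - move=> t.
    apply: (is_derive_eq (is_deriveM (is_derive_expR_cosh x t) (is_derive_sinhM mu t))).
    rewrite /GRing.scale /= /f /k /besselK_integrand -mulrBr.
    have -> : x / 2 * (expR (- (x * cosh t)) *
        (cosh ((mu + 1) * t) - cosh ((mu - 1) * t))) =
      x * expR (- (x * cosh t)) * (sinh t * sinh (mu * t)).
      by rewrite sinh_mul_sinh; field.
    ring.
  - move=> t; apply: cvgB; apply: cvgM; try exact: cvg_cst.
      exact: besselK_integrand_continuous.
    by apply: cvgB; exact: besselK_integrand_continuous.
  - move=> t t0; rewrite /f mulrDl mulrDl.
    apply: (le_trans (ler_normB _ _)); apply: lerD; rewrite normrM -mulrA.
      by apply: ler_wpM2l => //; rewrite ger0_norm// kC.
    rewrite ger0_norm; last by rewrite divr_ge0// ltW.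
    have h1 := kC _ _ mup t0; have h2 := kC _ _ mum t0.
    have h3 := k0 (mu + 1) t; have h4 := k0 (mu - 1) t.
    have h5 : `|k (mu + 1) t - k (mu - 1) t| <= C * expR (- t).
      by rewrite ler_norml; apply/andP; split; lra.
    apply: (@le_trans _ _ (x / 2 * (C * expR (- t)))).
      by rewrite ler_pM2l ?divr_gt0.
    by rewrite ler_wpM2r ?mulr_ge0 ?expR_ge0//; lra.
  - have h : C * expR (- (1 * t)) @[t --> +oo%R] --> (0 : R).
      rewrite -[X in _ --> X](mulr0 C); apply: cvgM; first exact: cvg_cst.
      exact: expRN_cvg0.
    have h' : - (C * expR (- (1 * t))) @[t --> +oo%R] --> (0 : R).
      by rewrite -[X in _ --> X]oppr0; apply: cvgN.
    apply: (squeeze_cvgr _ h' h).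
    near=> t.
    have t0 : 0 <= t by near: t; apply: nbhs_pinfty_ge; rewrite num_real.
    (* As |sinh| <= cosh, the primitive is bounded by the integrand of order mu, hence by C e^(-
       t). *)
    rewrite -ler_norml !mul1r; apply: le_trans (kC mu t mu0 t0).
    rewrite /k /besselK_integrand.
    rewrite normrM ger0_norm ?expR_ge0// ler_wpM2l ?expR_ge0//.
    have h1 := expR_ge0 (mu * t); have h2 := expR_ge0 (- (mu * t)).
    by rewrite /sinh /cosh ler_norml; apply/andP; split; lra.
rewrite mulr0 /sinh oppr0 subrr mul0r mulr0 subrr.
rewrite /f RintegralB//; last 2 first.
- exact: integrableMl_itv0y.
- by apply: integrableMl_itv0y; exact: integrableB_itv0y.
rewrite RintegralZl// RintegralZl//; last first.
  exact: integrableB_itv0y.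
rewrite RintegralB// => /eqP; rewrite subr_eq0 => /eqP; exact.
Unshelve. all: by end_near.
Qed.

(** Differentiation under the integral sign. On ]x / 2, x + 1[ the argument stays away from 0, so a
    single majorant C e^(- t) serves the whole neighbourhood. *)
Lemma is_derive_besselK {R : realType} (mu x : R) : 0 < x ->
  is_derive x 1 (besselK mu) (- (besselK (mu + 1) x + besselK (mu - 1) x) / 2).
Proof.
move=> x0.
have ik (nu y : R) : 0 < y ->
    lebesgue_measure.-integrable `[0%R, +oo[ (EFin \o besselK_integrand nu y).
  exact: integrable_besselK_integrand.
have dk (y t : R) : is_derive y 1 (fun z => besselK_integrand mu z t)
    (- cosh t * besselK_integrand mu y t).
  have h := is_derive_expRN (cosh t) y.
  rewrite (_ : (fun z => _) =
    cosh (mu * t) \*: (fun z => expR (- (cosh t * z)))); last first.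
    by apply/funext => z; rewrite /besselK_integrand mulrC [z * cosh t]mulrC.
  apply: (is_derive_eq (is_deriveZ (cosh (mu * t)) h)).
  by rewrite /GRing.scale /= /besselK_integrand [y * _]mulrC; ring.
pose B : set R := `[0, +oo[%classic.
pose x1 := x / 2.
have x10 : 0 < x1 by rewrite divr_gt0.
pose C := expR ((`|mu| + 1 + 1) ^+ 2 / x1).
have Ia : `]x1, (x + 1)[%classic x by rewrite /= in_itv/= /x1; lra.
have intf y : `]x1, (x + 1)[%classic y ->
    lebesgue_measure.-integrable B (EFin \o besselK_integrand mu y).
  by rewrite /= in_itv/= => /andP[h _]; apply: ik; apply: lt_trans h.
have der y t : `]x1, (x + 1)[%classic y -> B t ->
    derivable (fun z => besselK_integrand mu z t) y 1.
  by move=> _ _; case: (dk y t).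
have E y t : partial1of2 (besselK_integrand mu) y t =
    - 2^-1 * (besselK_integrand (mu + 1) y t + besselK_integrand (mu - 1) y t).
  rewrite partial1of2E; have [_ ->] := dk y t.
  by rewrite /besselK_integrand -mulrDr mulrCA mulNr cosh_mul_cosh; field.
have intG : lebesgue_measure.-integrable B (EFin \o (fun t => C * expR (- (1 * t)))).
  exact: (integrableMl_itv0y C _ (integrable_expRN _ (@ltr01 R))).
have G0 (t : R) : 0 <= C * expR (- (1 * t)) by rewrite mulr_ge0 ?expR_ge0.
have ub y t : `]x1, (x + 1)[%classic y -> B t ->
    `|partial1of2 (besselK_integrand mu) y t| <= C * expR (- (1 * t)).
  rewrite /B /= !in_itv/= andbT => /andP[yx _] t0; rewrite E mul1r.
  have h1 : besselK_integrand (mu + 1) y t <= C * expR (- t).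
    apply: besselK_integrand_le => //; first exact: ltW.
    by rewrite (le_trans (ler_normD _ _))// normr1.
  have h2 : besselK_integrand (mu - 1) y t <= C * expR (- t).
    apply: besselK_integrand_le => //; first exact: ltW.
    by rewrite (le_trans (ler_normB _ _))// normr1.
  have := besselK_integrand_ge0 (mu + 1) y t.
  have := besselK_integrand_ge0 (mu - 1) y t.
  by move=> *; rewrite ler_norml; apply/andP; split; lra.
split; first exact: (@derivable_under_integral R _ (measurableTypeR R) lebesgue_measure
  (besselK_integrand mu) B (measurable_itv _) x x1 (x + 1) Ia intf der _ G0 intG ub).
rewrite -derive1E.
rewrite [LHS](@differentiation_under_integral R _ (measurableTypeR R) lebesgue_measure
  (besselK_integrand mu) B (measurable_itv _) x x1 (x + 1) Ia intf der _ G0 intG ub).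
under eq_Rintegral do rewrite E.
have mB : measurable (B : set (measurableTypeR R)) by exact: measurable_itv.
rewrite RintegralZl; [|exact: mB|]; last first.
  rewrite (_ : _ \o _ = (fun t =>
    (besselK_integrand (mu + 1) x t)%:E + (besselK_integrand (mu - 1) x t)%:E)%E)//.
  by apply: integrableD; [exact: mB|exact: ik|exact: ik].
rewrite RintegralD; [|exact: mB|exact: ik|exact: ik].
by rewrite /besselK mulrC mulrN mulNr.
Qed.

Lemma besselK_ge0 {R : realType} (mu x : R) : 0 <= besselK mu x.
Proof. by apply: Rintegral_ge0 => t _; exact: besselK_integrand_ge0. Qed.

Lemma cosh_mul_le {R : realType} (a b : R) : 0 <= a + b -> b <= a -> cosh b <= cosh a.
Proof.
move=> ab ba; rewrite /cosh ler_pM2r ?invr_gt0// -subr_ge0.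
(* Each factor is non-negative by one of the hypotheses, which together say |b| <= a. *)
have -> : expR a + expR (- a) - (expR b + expR (- b)) =
    (expR a - expR b) * (1 - expR (- (a + b))).
  have h1 : expR a * expR (- (a + b)) = expR (- b) by rewrite -expRD; congr expR; ring.
  have h2 : expR b * expR (- (a + b)) = expR (- a) by rewrite -expRD; congr expR; ring.
  by rewrite mulrBr mulr1 mulrBl h1 h2; ring.
by rewrite mulr_ge0// subr_ge0 ?ler_expR// expR_le1 oppr_le0.
Qed.

(** The condition on the sum of the orders admits negative ones: for mu = nu' and nu = nu' + 1 it
    reads 2 nu' + 1 >= 0. *)
Lemma le_besselK {R : realType} (mu nu x : R) : 0 < x -> 0 <= nu + mu -> mu <= nu ->
  besselK mu x <= besselK nu x.
Proof.
move=> x0 h1 h2; apply: le_Rintegral => //.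
- exact: integrable_besselK_integrand.
- exact: integrable_besselK_integrand.
move=> t; rewrite /= in_itv/= andbT => t0.
apply: ler_wpM2l; first exact: expR_ge0.
by apply: cosh_mul_le; [rewrite -mulrDl mulr_ge0|exact: ler_wpM2r].
Qed.

(** The substitution s = (x / 2) e^t turns the left side into (x / 2)^(- mu) times the Gamma
    integral restricted to [x / 2, +oo[. *)
Lemma integral_expR_expR {R : realType} (mu x : R) : 0 < mu -> 0 < x ->
  (\int[lebesgue_measure]_(t in `[0%R, +oo[)
     (expR (- (x / 2 * expR t)) * expR (mu * t))%:E
   <= ((x / 2) `^ (- mu) * gamma_integral mu)%:E)%E.
Proof.
move=> mu0 x0.
set c := x / 2; have c0 : 0 < c by rewrite divr_gt0.
pose G (t : R) := expR (- (c * expR t)) * expR (mu * t).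
(* The inverse substitution t = ln (s / c), which sends c to 0. *)
pose F (s : R) := ln s - ln c.
have dF (s : R) : 0 < s -> is_derive s 1 F s^-1.
  move=> s0.
  apply: (is_derive_eq (is_deriveB (is_derive1_ln s0) (is_derive_cst (ln c) s 1))).
  by rewrite subr0.
have F'E (s : R) : 0 < s -> F^`()%classic s = s^-1.
  by move=> s0; rewrite derive1E; case: (dF s s0).
have Fc : F c = 0 by rewrite /F subrr.
have cG : continuous G.
  move=> t; apply: cvgM; last exact: is_derive_continuous (is_derive_expRM mu t).
  apply: (@continuous_comp _ _ _ expR (fun s => expR (- (c * s)))).
    exact: continuous_expR.
  exact: is_derive_continuous (is_derive_expRN c _).
have GF (s : R) : 0 < s -> G (F s) * F^`()%classic s = c `^ (- mu) * gamma_integrand mu s.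
  move=> s0; rewrite F'E// /G /F expRB !lnK ?posrE//.
  have -> : c * (s / c) = s by field; rewrite gt_eqF.
  have -> : expR (mu * (ln s - ln c)) = s `^ mu * c `^ (- mu).
    by rewrite /powR !gt_eqF// -expRD; congr expR; ring.
  rewrite /gamma_integrand powRB ?(gt_eqF s0) ?implybT// powRr1 ?ltW//; ring.
have -> : (\int[lebesgue_measure]_(t in `[0%R, +oo[) (G t)%:E =
    \int[lebesgue_measure]_(s in `[c, +oo[)
      ((c `^ (- mu))%:E * (gamma_integrand mu s)%:E))%E.
  transitivity (\int[lebesgue_measure]_(s in `[c, +oo[)
    (((G \o F) * F^`()%classic) s)%:E)%E; last first.
    apply: eq_integral => s; rewrite inE/= in_itv/= andbT => cs.
    rewrite -EFinM; congr EFin.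
    by apply: GF; apply: lt_le_trans cs.
  rewrite -[X in `[X, +oo[%classic]Fc.
  apply: increasing_ge0_integration_by_substitutiony.
  - move=> s t; rewrite !in_itv/= !andbT => cs ct st.
    by rewrite ltrD2r ltr_ln ?posrE//; [apply: lt_le_trans cs|apply: lt_le_trans ct].
  - move=> s; rewrite in_itv/= andbT => cs.
    have s0 : 0 < s by apply: lt_trans cs.
    rewrite /continuous_at F'E//.
    apply: (@cvg_trans _ (z^-1 @[z --> s])); last by exact: inv_continuous (lt0r_neq0 s0).
    apply: near_eq_cvg; near=> z; apply/esym/F'E.
    by near: z; exact: lt_nbhsr.
  - apply/cvg_ex; exists c^-1.
    apply: (@cvg_trans _ (z^-1 @[z --> c^'+])).
      apply: near_eq_cvg; near=> z; apply/esym/F'E.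
      by apply: lt_trans c0 _; near: z; exact: nbhs_right_gt.
    by apply: cvg_at_right_filter; exact: inv_continuous (lt0r_neq0 c0).
  - apply/cvg_ex; exists 0.
    apply: (@cvg_trans _ (z^-1 @[z --> +oo%R])).
      apply: near_eq_cvg; near=> z; apply/esym/F'E.
      by near: z; apply: nbhs_pinfty_gt; rewrite num_real.
    apply/gtr0_cvgV0; last exact: cvg_id.
    by apply: nbhs_pinfty_gt; rewrite num_real.
  - split.
      move=> s; rewrite in_itv/= andbT => cs.
      by have [] := dF s (lt_trans c0 cs).
    by apply: cvg_at_right_filter; exact: is_derive_continuous (dF c c0).
  - apply/cvgryPge => A; near=> s.
    have s0 : 0 < s by near: s; apply: nbhs_pinfty_gt; rewrite num_real.
    rewrite /F lerBrDr -ler_expR [leRHS]lnK; last by rewrite posrE.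
    by near: s; apply: nbhs_pinfty_ge; rewrite num_real.
  - by apply: continuous_in_subspaceT => t _; exact: cG.
  - by move=> t _; rewrite /G mulr_ge0 ?expR_ge0.
have sub : `[c, +oo[%classic `<=` (`]0, +oo[%classic : set R).
  by move=> s; rewrite /= !in_itv/= !andbT; apply: lt_le_trans.
have mg := measurable_int _ (integrable_gamma_integrand _ mu0).
rewrite ge0_integralZl//; last 3 first.
- exact: measurable_funS mg.
- by move=> s _; rewrite lee_fin gamma_integrand_ge0.
- by rewrite lee_fin powR_ge0.
rewrite EFinM; apply: lee_wpmul2l; first by rewrite lee_fin powR_ge0.
rewrite /gamma_integral /Rintegral fineK; last first.
  by apply: integrable_fin_num => //; exact: integrable_gamma_integrand.
apply: ge0_subset_integral => //.
by move=> s _; rewrite lee_fin gamma_integrand_ge0.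
Unshelve. all: by end_near.
Qed.

(** Split cosh(mu t) into its two exponentials. Against e^(mu t) use cosh t >= e^t / 2 and the
    previous lemma; against e^(- mu t) bound e^(- x cosh t) by 1. *)
Lemma besselK_le {R : realType} (mu x : R) : 0 < mu -> 0 < x ->
  besselK mu x <= 2^-1 * ((x / 2) `^ (- mu) * gamma_integral mu) + (2 * mu)^-1.
Proof.
move=> mu0 x0; rewrite -lee_fin /besselK /Rintegral fineK; last first.
  by apply: integrable_fin_num => //; exact: integrable_besselK_integrand.
have c0 : 0 <= 2^-1 :> R by [].
pose G (t : R) := expR (- (x / 2 * expR t)) * expR (mu * t).
have cG : continuous G.
  move=> t; apply: cvgM; last exact: is_derive_continuous (is_derive_expRM mu t).
  apply: (@continuous_comp _ _ _ expR (fun s => expR (- (x / 2 * s)))).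
    exact: continuous_expR.
  exact: is_derive_continuous (is_derive_expRN (x / 2) _).
have mG : measurable_fun (`[0, +oo[%classic : set R) (EFin \o G).
  by apply/measurable_EFinP; apply: measurable_funTS; exact: continuous_measurable_fun.
have mE := measurable_int _ (integrable_expRN _ mu0).
have G0 t : 0 <= G t by rewrite mulr_ge0 ?expR_ge0.
apply: (@le_trans _ _ (\int[lebesgue_measure]_(t in `[0%R, +oo[)
  ((2^-1)%:E * (G t)%:E + (2^-1)%:E * (expR (- (mu * t)))%:E))%E).
  apply: ge0_le_integral => //=.
  - by move=> t _; rewrite lee_fin besselK_integrand_ge0.
  - exact: measurable_int (integrable_besselK_integrand mu _ x0).
  - by apply: emeasurable_funD; apply: measurable_funeM.
  - move=> t; rewrite in_itv/= andbT => t0.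
    rewrite -!EFinM -EFinD lee_fin /cosh /G.
    have h1 : expR (- (x * ((expR t + expR (- t)) / 2))) <= expR (- (x / 2 * expR t)).
      rewrite ler_expR lerN2 mulrA [leRHS]mulrAC ler_wpM2l ?(ltW x0)//; last first.
        by rewrite lerDl expR_ge0.
      by rewrite divr_ge0// ltW.
    have h2 : expR (- (x * ((expR t + expR (- t)) / 2))) <= 1.
      by rewrite expR_le1 oppr_le0 mulr_ge0 ?divr_ge0 ?addr_ge0 ?expR_ge0// ltW.
    have e1 := expR_ge0 (mu * t); have e2 := expR_ge0 (- (mu * t)).
    have := ler_wpM2r e1 h1; have := ler_wpM2r e2 h2; lra.
rewrite ge0_integralD//; last 3 first.
- by move=> t _; rewrite -EFinM lee_fin mulr_ge0.
- exact: measurable_funeM.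
- exact: measurable_funeM.
rewrite EFinD; apply: leeD.
  rewrite ge0_integralZl//; last by move=> t _; rewrite lee_fin.
  by rewrite [leRHS]EFinM; apply: lee_wpmul2l => //; exact: integral_expR_expR.
rewrite ge0_integralZl//.
by rewrite integral_expRN// -EFinM lee_fin invfM.
Qed.

(** * The integral of the Bessel function I *)

(* For [x > 0], [x `^ nu * besselI nu x] and [x `^ nu * besselI (nu + 1) x] are
   [2 `^ (- nu) * x `^ (2 * nu)] times the following two functions. *)
Definition besselI_even {R : realType} (nu x : R) : R :=
  bessel_entire nu (x ^+ 2 / 4).

Definition besselI_odd {R : realType} (nu x : R) : R :=
  x / 2 * bessel_entire (nu + 1) (x ^+ 2 / 4).

Lemma is_derive_besselI_even {R : realType} (nu x : R) : 0 < nu + 1 ->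
  is_derive x 1 (besselI_even nu) (besselI_odd nu x).
Proof.
move=> nu1.
have h : is_derive x 1 (fun z : R => z ^+ 2 / 4) (x / 2).
  rewrite (_ : (fun z => _) = 4^-1 \*: (fun z : R => z * z)); last first.
    by apply/funext => z; rewrite mulrC expr2.
  apply: (is_derive_eq (is_deriveZ 4^-1
    (is_deriveM (is_derive_id x 1) (is_derive_id x 1)))).
  by rewrite /GRing.scale /=; field.
apply: (is_derive_eq (@is_derive1_comp _ (bessel_entire nu) _ x _ _
  (is_derive_bessel_entire _ _ nu1) h)).
by rewrite mulrC.
Qed.

Lemma is_derive_besselI_odd {R : realType} (nu x : R) : 0 < nu + 1 -> 0 < x ->
  is_derive x 1 (besselI_odd nu)
    (besselI_even nu x - (2 * nu + 1) * besselI_odd nu x / x).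
Proof.
move=> nu1 x0; have nu2 : 0 < nu + 1 + 1 by rewrite addr_gt0.
have h1 : is_derive x 1 (fun z : R => z / 2) 2^-1.
  rewrite (_ : (fun z => _) = 2^-1 \*: (fun z : R => z)); last first.
    by apply/funext => z; rewrite mulrC.
  apply: (is_derive_eq (is_deriveZ 2^-1 (is_derive_id x 1))).
  by rewrite /GRing.scale /= mulr1.
apply: (is_derive_eq (is_deriveM h1 (is_derive_besselI_even _ x nu2))).
rewrite /GRing.scale /= /besselI_even /besselI_odd.
(* A, B, C stand for the entire factors of orders nu, nu + 1, nu + 2; the recurrence eliminates the
   last. *)
have alg (A B C : R) : A = (nu + 1) * B + x ^+ 2 / 4 * C ->
    x / 2 * (x / 2 * C) + B / 2 = A - (2 * nu + 1) * (x / 2 * B) / x.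
  by move=> ->; field; rewrite gt_eqF.
exact: alg (bessel_entire_recE _ _ nu1).
Qed.

Lemma besselI_even_ge0 {R : realType} (nu x : R) : 0 < nu + 1 ->
  0 <= besselI_even nu x.
Proof. by move=> nu1; apply: bessel_entire_ge0; rewrite ?divr_ge0 ?sqr_ge0. Qed.

Lemma besselI_odd_ge0 {R : realType} (nu x : R) : 0 < nu + 1 -> 0 <= x ->
  0 <= besselI_odd nu x.
Proof.
move=> nu1 x0; apply: mulr_ge0; first by rewrite divr_ge0.
by apply: bessel_entire_ge0; [exact: addr_gt0|rewrite divr_ge0 ?sqr_ge0].
Qed.

Lemma besselI_even_continuous {R : realType} (nu : R) : 0 < nu + 1 ->
  continuous (besselI_even nu).
Proof. by move=> nu1 x; exact: is_derive_continuous (is_derive_besselI_even _ x nu1). Qed.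

Lemma besselI_odd_continuous {R : realType} (nu : R) : 0 < nu + 1 ->
  continuous (besselI_odd nu).
Proof.
move=> nu1 x; apply: cvgM; first by apply: cvgM; [exact: cvg_id|exact: cvg_cst].
by apply: besselI_even_continuous; rewrite addr_gt0.
Qed.

Lemma besselI_even_cvg0 {R : realType} (nu : R) : 0 < nu + 1 ->
  besselI_even nu x @[x --> 0^'+] --> rgamma (nu + 1).
Proof.
move=> nu1; rewrite -bessel_entire0.
have -> : bessel_entire nu 0 = besselI_even nu 0 by rewrite /besselI_even expr0n mul0r.
by apply: cvg_at_right_filter; apply: besselI_even_continuous.
Qed.

Lemma besselI_odd_cvg0 {R : realType} (nu : R) : 0 < nu + 1 ->
  besselI_odd nu x @[x --> 0^'+] --> 0.
Proof.
move=> nu1; have e : besselI_odd nu 0 = 0 by rewrite /besselI_odd !mul0r.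
rewrite -[X in _ --> X]e.
by apply: cvg_at_right_filter; apply: besselI_odd_continuous.
Qed.

(** For t > 0 this is 2^nu e^(s t) t^nu I_nu(t), the integrand of the theorem up to a constant when
    s = beta. *)
Definition bessel_weight {R : realType} (nu s t : R) : R :=
  expR (s * t) * t `^ (2 * nu) * besselI_even nu t.

Lemma bessel_weight_ge0 {R : realType} (nu s t : R) : 0 < nu + 1 ->
  0 <= bessel_weight nu s t.
Proof. by move=> nu1; rewrite !mulr_ge0 ?expR_ge0 ?powR_ge0 ?besselI_even_ge0. Qed.

Lemma bessel_weight_continuous {R : realType} (nu s t : R) : 0 < nu + 1 -> 0 < t ->
  {for t, continuous (bessel_weight nu s)}.
Proof.
move=> nu1 t0; apply: cvgM; last exact: besselI_even_continuous.
apply: cvgM; last exact: continuous_powR_gt0.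
exact: is_derive_continuous (is_derive_expRM s t).
Qed.

(* At the endpoints [s = 1] and [s = -1] the weight has an explicit primitive. *)
Lemma integral_bessel_weight {R : realType} (nu s x : R) :
  - (1 / 2) < nu -> s * s = 1 -> 0 < x ->
  (\int[lebesgue_measure]_(t in `]0%R, x]) (bessel_weight nu s t)%:E =
   (expR (s * x) * x `^ (2 * nu + 1) * (besselI_even nu x - s * besselI_odd nu x)
     / (2 * nu + 1))%:E)%E.
Proof.
move=> nuh ss x0.
have nu1 : 0 < nu + 1 by lra.
have m0 : 0 < 2 * nu + 1 by lra.
apply: (@ge0_FTC2_at0 _ (bessel_weight nu s) (fun x => expR (s * x) * x `^ (2 * nu + 1) *
  (besselI_even nu x - s * besselI_odd nu x) / (2 * nu + 1))) => //.
- by move=> t _; exact: bessel_weight_ge0.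
- move=> t t0.
  rewrite (_ : (fun x => _) = (2 * nu + 1)^-1 \*: ((fun x => expR (s * x)) *
    (fun x => x `^ (2 * nu + 1)) * (besselI_even nu \- s \*: besselI_odd nu))); last first.
    by apply/funext => z; rewrite mulrC.
  have h1 := is_derive_expRM s t.
  have h2 := is_derive1_powR (2 * nu + 1) t0.
  have h3 := is_derive_besselI_even _ t nu1.
  have h4 := is_derive_besselI_odd _ _ nu1 t0.
  apply: (is_derive_eq (is_deriveZ (2 * nu + 1)^-1
    (is_deriveM (is_deriveM h1 h2) (is_deriveB h3 (is_deriveZ s h4))))).
  rewrite /GRing.scale /= /bessel_weight !fctE.
  rewrite -(mulr_powRB1 (ltW t0) m0) addrK.
  have -> : (s \*: besselI_odd nu) t = s * besselI_odd nu t by [].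
  move: (expR (s * t)) (t `^ (2 * nu)) (besselI_even nu t) (besselI_odd nu t) => e p A B.
  apply: (mulfI (lt0r_neq0 m0)).
  (* Differentiating the primitive leaves the extra term (1 - s^2) e t p B, which is zero by
     [ss]. *)
  have -> : (2 * nu + 1) * (e * p * A) = (2 * nu + 1) * (e * p * A)
    + (1 - s * s) * (e * t * p * B) by rewrite ss subrr mul0r addr0.
  by field; rewrite !gt_eqF.
- by move=> t; exact: bessel_weight_continuous.
(* The primitive vanishes at 0+ because the exponent 2 nu + 1 is positive and the other factors have
   finite limits. *)
- rewrite -[X in _ --> X](mul0r (2 * nu + 1)^-1).
  apply: cvgM; last exact: cvg_cst.
  rewrite -[X in _ --> X](mul0r (rgamma (nu + 1) - s * 0)).
  apply: cvgM.
    rewrite -[X in _ --> X](mulr0 (expR (s * 0))); apply: cvgM; last exact: powR_cvg0.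
    by apply: cvg_at_right_filter; exact: is_derive_continuous (is_derive_expRM s 0).
  apply: cvgB; first exact: besselI_even_cvg0.
  by apply: cvgM; [exact: cvg_cst|exact: besselI_odd_cvg0].
Qed.

Lemma integrable_bessel_weight1 {R : realType} (nu s x : R) :
  - (1 / 2) < nu -> s * s = 1 -> 0 < x ->
  lebesgue_measure.-integrable `]0%R, x] (EFin \o bessel_weight nu s).
Proof.
move=> nuh ss x0; have nu1 : 0 < nu + 1 by lra.
apply/integrableP; split.
  apply/measurable_EFinP; apply: continuous_gt0_measurable.
    by move=> t; rewrite /= !in_itv/= andbT => /andP[].
  by move=> t; exact: bessel_weight_continuous.
under eq_integral do rewrite gee0_abs ?lee_fin ?bessel_weight_ge0//.
by rewrite integral_bessel_weight// ltry.
Qed.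

Lemma Rintegral_bessel_weight {R : realType} (nu s x : R) :
  - (1 / 2) < nu -> s * s = 1 -> 0 < x ->
  \int[lebesgue_measure]_(t in `]0, x]) bessel_weight nu s t =
   expR (s * x) * x `^ (2 * nu + 1) * (besselI_even nu x - s * besselI_odd nu x)
     / (2 * nu + 1).
Proof. by move=> nuh ss x0; rewrite /Rintegral integral_bessel_weight. Qed.

(** The integral of the weight at s = 1 is non-negative and is a positive multiple of the
    difference. *)
Lemma besselI_odd_le_even {R : realType} (nu x : R) : - (1 / 2) < nu -> 0 < x ->
  besselI_odd nu x <= besselI_even nu x.
Proof.
move=> nuh x0; have nu1 : 0 < nu + 1 by lra.
have m0 : 0 < 2 * nu + 1 by lra.
have : 0 <= \int[lebesgue_measure]_(t in `]0, x]) bessel_weight nu 1 t.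
  by apply: Rintegral_ge0 => t _; exact: bessel_weight_ge0.
rewrite Rintegral_bessel_weight ?mulr1// !mul1r.
by rewrite pmulr_lge0 ?invr_gt0// pmulr_rge0 ?mulr_gt0 ?expR_gt0 ?powR_gt0// subr_ge0.
Qed.

(** For t > 0 the weight at beta < 1 is dominated by the weight at s = 1. *)
Lemma integrable_bessel_weight {R : realType} (nu beta x : R) :
  - (1 / 2) < nu -> beta < 1 -> 0 < x ->
  lebesgue_measure.-integrable `]0%R, x] (EFin \o bessel_weight nu beta).
Proof.
move=> nuh b1 x0; have nu1 : 0 < nu + 1 by lra.
apply: (le_integrable _ _ _ (integrable_bessel_weight1 _ 1 _ nuh (mulr1 1) x0)) => //.
  apply/measurable_EFinP; apply: continuous_gt0_measurable.
    by move=> t; rewrite /= !in_itv/= andbT => /andP[].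
  by move=> t; exact: bessel_weight_continuous.
move=> t; rewrite /= in_itv/= => /andP[t0 _].
rewrite lee_fin !ger0_norm ?bessel_weight_ge0//.
rewrite ler_wpM2r ?besselI_even_ge0// ler_wpM2r ?powR_ge0// ler_expR.
by rewrite ler_wpM2r// ltW.
Qed.

Lemma integral_besselI_bounds {R : realType} (nu beta x : R) :
  - (1 / 2) < nu -> -1 < beta -> beta < 1 -> 0 < x ->
  2 `^ (- nu) * x `^ (2 * nu + 1) / (2 * nu + 1) *
    (besselI_even nu x - besselI_odd nu x) <=
  expR (- (beta * x)) *
    \int[lebesgue_measure]_(t in `[0, x]) (expR (beta * t) * t `^ nu * besselI nu t) <=
  2 `^ (- nu) * x `^ (2 * nu + 1) / (2 * nu + 1) *
    (besselI_even nu x + besselI_odd nu x).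
Proof.
move=> nuh b1 b2 x0; have nu1 : 0 < nu + 1 by lra.
have iw := integrable_bessel_weight _ _ _ nuh b2 x0.
have i1 := integrable_bessel_weight1 _ 1 _ nuh (mulr1 1) x0.
have n11 : (-1) * (-1) = 1 :> R by rewrite mulrNN mulr1.
have iN1 := integrable_bessel_weight1 _ (-1) _ nuh n11 x0.
have mI : measurable (`]0, x]%classic : set (measurableTypeR R)) by exact: measurable_itv.
have iZ k s : lebesgue_measure.-integrable `]0%R, x] (EFin \o bessel_weight nu s) ->
    lebesgue_measure.-integrable `]0%R, x] (EFin \o (fun t => k * bessel_weight nu s t)).
  move=> h; rewrite (_ : _ \o _ = (fun t => k%:E * (bessel_weight nu s t)%:E)%E)//.
  by apply: integrableZl.
have wE t : 0 < t -> expR (beta * t) * t `^ nu * besselI nu t =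
    2 `^ (- nu) * bessel_weight nu beta t.
  move=> t0; rewrite besselIE// powRM ?(ltW t0) ?invr_ge0// /bessel_weight /besselI_even.
  rewrite (_ : 2 * nu = nu + nu); last by ring.
  rewrite powRD ?(gt_eqF t0) ?implybT// -(powR_inv1 (ler0n R 2)) -powRrM mulN1r; ring.
have JE : expR (- (beta * x)) *
    \int[lebesgue_measure]_(t in `[0, x]) (expR (beta * t) * t `^ nu * besselI nu t) =
    2 `^ (- nu) * (expR (- (beta * x)) *
    \int[lebesgue_measure]_(t in `]0, x]) bessel_weight nu beta t).
  (* Dropping the null set {0} avoids the conventional value of the integrand there. *)
  rewrite -Rintegral_itv_obnd_cbnd; last first.
    apply: eq_integrable (iZ (2 `^ (- nu)) _ iw) => // t.
    rewrite inE/= in_itv/= => /andP[t0 _].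
    by rewrite wE.
  rewrite [RHS]mulrCA -[2 `^ (- nu) * _]RintegralZl//; congr (_ * _).
  apply: eq_Rintegral => t.
  by rewrite inE/= in_itv/= => /andP[t0 _]; exact: wE.
rewrite JE -!mulrA !ler_pM2l ?powR_gt0//.
rewrite -RintegralZl//; apply/andP; split.
(* Lower bound: the exponent - beta (x - t) exceeds - (x - t) by (1 - beta) (x - t) >= 0. *)
- have -> : x `^ (2 * nu + 1) * ((2 * nu + 1)^-1 *
      (besselI_even nu x - besselI_odd nu x)) =
    expR (- x) * (\int[lebesgue_measure]_(t in `]0, x]) bessel_weight nu 1 t).
    rewrite Rintegral_bessel_weight ?mulr1// !mul1r.
    by rewrite !mulrA -expRD addNr expR0; ring.
  rewrite -RintegralZl//; apply: le_Rintegral => //; [exact: iZ|exact: iZ|].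
  move=> t; rewrite /= in_itv/= => /andP[t0 tx].
  rewrite /bessel_weight !mulrA -!expRD.
  rewrite ler_wpM2r ?besselI_even_ge0// ler_wpM2r ?powR_ge0// ler_expR.
  rewrite -subr_ge0 (_ : _ - _ = (1 - beta) * (x - t)); last by ring.
  by rewrite mulr_ge0// subr_ge0// ltW.
(* Upper bound: x - t exceeds - beta (x - t) by (1 + beta) (x - t) >= 0. *)
- have -> : x `^ (2 * nu + 1) * ((2 * nu + 1)^-1 *
      (besselI_even nu x + besselI_odd nu x)) =
    expR x * (\int[lebesgue_measure]_(t in `]0, x]) bessel_weight nu (-1) t).
    rewrite Rintegral_bessel_weight ?mulrNN ?mulr1// !mulN1r opprK.
    by rewrite !mulrA -expRD subrr expR0; ring.
  rewrite -RintegralZl//; apply: le_Rintegral => //; [exact: iZ|exact: iZ|].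
  move=> t; rewrite /= in_itv/= => /andP[t0 tx].
  rewrite /bessel_weight !mulrA -!expRD.
  rewrite ler_wpM2r ?besselI_even_ge0// ler_wpM2r ?powR_ge0// ler_expR.
  rewrite -subr_ge0 (_ : _ - _ = (1 + beta) * (x - t)); last by ring.
  by rewrite mulr_ge0// ?subr_ge0//; lra.
Qed.

(** * The Wronskian and the theorem *)

(** For x > 0 this is 2^nu x (I_nu K_(nu+1) + I_(nu+1) K_nu), that is 2^nu x times the Wronskian of
    K_nu and I_nu. *)
Definition bessel_wronskian {R : realType} (nu x : R) : R :=
  x `^ (nu + 1) *
  (besselI_even nu x * besselK (nu + 1) x + besselI_odd nu x * besselK nu x).

Lemma is_derive_bessel_wronskian {R : realType} (nu x : R) : 0 < nu + 1 -> 0 < x ->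
  is_derive x 1 (bessel_wronskian nu) 0.
Proof.
move=> nu1 x0.
have h1 := is_derive1_powR (nu + 1) x0.
have h2 := is_derive_besselI_even _ x nu1.
have h3 := is_derive_besselI_odd _ _ nu1 x0.
have h4 := is_derive_besselK (nu + 1) _ x0.
have h5 := is_derive_besselK nu _ x0.
have r4 := besselK_recE (nu + 1) _ x0.
have r5 := besselK_recE nu _ x0.
apply: (is_derive_eq (is_deriveM h1 (is_deriveD (is_deriveM h2 h4) (is_deriveM h3 h5)))).
rewrite addrK in h4 r4 *.
rewrite /GRing.scale /= !fctE -(mulr_powRB1 (ltW x0) nu1) addrK.
move: r4 r5.
move: (x `^ nu) (besselI_even nu x) (besselI_odd nu x) (besselK (nu + 1 + 1) x)
  (besselK (nu + 1) x) (besselK nu x) (besselK (nu - 1) x) => p A B K2 K1 K0 Km r4 r5.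
(* The recurrences express orders nu + 2 and nu - 1 through nu and nu + 1, after which everything
   cancels. *)
have -> : K2 = K0 + 2 * ((nu + 1) * K1) / x by rewrite r4; field; rewrite gt_eqF.
have -> : Km = K1 - 2 * (nu * K0) / x by rewrite r5; field; rewrite gt_eqF.
by field; rewrite gt_eqF.
Qed.

Lemma bessel_wronskian_cst {R : realType} (nu x y : R) : 0 < nu + 1 -> 0 < x -> 0 < y ->
  bessel_wronskian nu x = bessel_wronskian nu y.
Proof.
move=> nu1; wlog xy : x y / x <= y => [hw x0 y0|x0 y0].
  have [xy|/ltW yx] := leP x y; first exact: hw.
  by apply/esym; exact: hw.
have : (\int[lebesgue_measure]_(t in `[x, y]) (0 : R)%:E =
    (bessel_wronskian nu y - bessel_wronskian nu x)%:E)%E.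
  apply: (continuous_FTC2_itvcc (fun=> 0) _ _ _ xy) => [t /andP[xt _]|t _].
    by apply: is_derive_bessel_wronskian => //; apply: lt_le_trans xt.
  exact: cvg_cst.
by rewrite integral0 => h; rewrite (subr0_eq (esym (EFin_inj h))).
Qed.

(** The bound of [besselK_le] multiplied by x^mu, for x > 0: the singular power cancels and a finite
    limit at 0+ remains. *)
Definition besselK_bound {R : realType} (mu x : R) : R :=
  2^-1 * (2 `^ mu * gamma_integral mu) + x `^ mu * (2 * mu)^-1.

Lemma powR_besselK_le {R : realType} (mu x : R) : 0 < mu -> 0 < x ->
  x `^ mu * besselK mu x <= besselK_bound mu x.
Proof.
move=> mu0 x0; apply: (le_trans (ler_wpM2l (powR_ge0 _ _) (besselK_le _ _ mu0 x0))).
have h : x `^ mu * (x / 2) `^ (- mu) = 2 `^ mu.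
  rewrite powRM ?(ltW x0) ?invr_ge0// mulrA -powRD ?(gt_eqF x0) ?implybT//.
  by rewrite subrr powRr0 mul1r -(powR_inv1 (ler0n R 2)) -powRrM mulrNN mul1r.
by rewrite /besselK_bound -h le_eqVlt; apply/predU1P; left; ring.
Qed.

Lemma besselK_bound_cvg0 {R : realType} (mu : R) : 0 < mu ->
  besselK_bound mu x @[x --> 0^'+] --> 2^-1 * (2 `^ mu * gamma_integral mu).
Proof.
move=> mu0; rewrite -[X in _ --> X]addr0 -[X in _ --> _ + X](mul0r (2 * mu)^-1).
apply: cvgD; first exact: cvg_cst.
by apply: cvgM; [exact: powR_cvg0|exact: cvg_cst].
Qed.

Lemma bessel_cross_bounds {R : realType} (nu x : R) : - (1 / 2) < nu -> 0 < x ->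
  0 <= besselI_odd nu x * (x `^ (nu + 1) * besselK nu x) <=
  besselI_odd nu x * besselK_bound (nu + 1) x.
Proof.
move=> nuh x0; have nu1 : 0 < nu + 1 by lra.
have B0 := besselI_odd_ge0 _ _ nu1 (ltW x0).
apply/andP; split.
  by apply: mulr_ge0 => //; rewrite mulr_ge0 ?powR_ge0 ?besselK_ge0.
apply: ler_wpM2l => //; apply: le_trans (powR_besselK_le _ _ nu1 x0).
by apply: ler_wpM2l; [exact: powR_ge0|apply: le_besselK => //; lra].
Qed.

Lemma bessel_cross_cvg0 {R : realType} (nu : R) : - (1 / 2) < nu ->
  besselI_odd nu x * (x `^ (nu + 1) * besselK nu x) @[x --> 0^'+] --> 0.
Proof.
move=> nuh; have nu1 : 0 < nu + 1 by lra.
apply: (@squeeze_cvgr _ _ _ _ (cst 0)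
  (fun x => besselI_odd nu x * besselK_bound (nu + 1) x)).
- by near=> x; exact: bessel_cross_bounds.
- exact: cvg_cst.
- rewrite -[X in _ --> X]
    (mul0r (2^-1 * (2 `^ (nu + 1) * gamma_integral (nu + 1)))).
  by apply: cvgM; [exact: besselI_odd_cvg0|exact: besselK_bound_cvg0].
Unshelve. all: by end_near.
Qed.

Lemma bessel_wronskianE {R : realType} (nu x : R) :
  bessel_wronskian nu x = besselI_even nu x * (x `^ (nu + 1) * besselK (nu + 1) x) +
    besselI_odd nu x * (x `^ (nu + 1) * besselK nu x).
Proof. by rewrite /bessel_wronskian mulrDr; congr (_ + _); exact: mulrCA. Qed.

Lemma bessel_wronskian_le {R : realType} (nu x : R) : - (1 / 2) < nu -> 0 < x ->
  bessel_wronskian nu x <= 2 `^ nu.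
Proof.
move=> nuh x0; have nu1 : 0 < nu + 1 by lra.
pose U := besselK_bound (nu + 1).
have lim2 : 2 `^ nu = rgamma (nu + 1) *
    (2^-1 * (2 `^ (nu + 1) * gamma_integral (nu + 1))) + 0 :> R.
  rewrite rgammaE// -(mulr_powRB1 (ler0n R 2) nu1) addrK.
  by field; rewrite gt_eqF// gamma_integral_gt0.
have h : besselI_even nu y * U y + besselI_odd nu y * U y
    @[y --> 0^'+] --> (2 `^ nu : R).
  rewrite lim2; apply: cvgD.
    by apply: cvgM; [exact: besselI_even_cvg0|exact: besselK_bound_cvg0].
  rewrite -[X in _ --> X]
    (mul0r (2^-1 * (2 `^ (nu + 1) * gamma_integral (nu + 1)))).
  by apply: cvgM; [exact: besselI_odd_cvg0|exact: besselK_bound_cvg0].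
(* By constancy the Wronskian at x may be evaluated at y near 0, where it is at most (A + B) U,
   which tends to 2^nu. *)
apply: (cvgr_to_ge h); near=> y.
have y0 : 0 < y by near: y; exact: nbhs_right_gt.
rewrite (bessel_wronskian_cst _ _ _ nu1 x0 y0) bessel_wronskianE; apply: lerD.
  by apply: ler_wpM2l; [exact: besselI_even_ge0|exact: powR_besselK_le].
by case/andP: (bessel_cross_bounds _ _ nuh y0).
Unshelve. all: by end_near.
Qed.

(** Solve the Wronskian identity for this product; the constant is read off at the arbitrary point
    1. *)
Lemma powR_besselK_is_cvg0 {R : realType} (nu : R) : - (1 / 2) < nu ->
  x `^ (nu + 1) * besselK (nu + 1) x @[x --> 0^'+] -->
  bessel_wronskian nu 1 / rgamma (nu + 1).
Proof.
move=> nuh; have nu1 : 0 < nu + 1 by lra.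
have g0 := rgamma_gt0 _ nu1.
have A0 := @besselI_even_cvg0 R _ nu1.
have H : (bessel_wronskian nu 1 - besselI_odd nu x * (x `^ (nu + 1) * besselK nu x)) /
    besselI_even nu x @[x --> 0^'+] --> (bessel_wronskian nu 1 - 0) / rgamma (nu + 1).
  apply: cvgM; first by apply: cvgB; [exact: cvg_cst|exact: bessel_cross_cvg0].
  by apply: cvgV => //; exact: lt0r_neq0.
rewrite subr0 in H; apply: cvg_trans H.
apply: near_eq_cvg; near=> x.
have x0 : 0 < x by near: x; exact: nbhs_right_gt.
(* Division by A is legitimate near 0+ because its limit 1 / Gamma(nu + 1) is positive. *)
have Ax0 : 0 < besselI_even nu x by near: x; exact: cvgr_gt A0 _ g0.
rewrite (bessel_wronskian_cst _ _ _ nu1 (@ltr01 R) x0) bessel_wronskianE addrK.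
by rewrite mulrAC divff ?mul1r// gt_eqF.
Unshelve. all: by end_near.
Qed.

Lemma bessel_expr_bounds {R : realType} (nu beta x : R) :
  - (1 / 2) < nu -> -1 < beta -> beta < 1 -> 0 < x ->
  let P := 2 `^ (- nu) / (2 * nu + 1) * (x `^ (nu + 1) * besselK (nu + 1) x) in
  P * (besselI_even nu x - besselI_odd nu x) <= bessel_expr nu beta x <=
  P * (besselI_even nu x + besselI_odd nu x).
Proof.
move=> nuh b1 b2 x0 /=.
have E : bessel_expr nu beta x = besselK (nu + 1) x / x `^ nu *
    (expR (- (beta * x)) *
    \int[lebesgue_measure]_(t in `[0, x]) (expR (beta * t) * t `^ nu * besselI nu t)).
  by rewrite /bessel_expr; ring.
have K0 : 0 <= besselK (nu + 1) x / x `^ nu by rewrite divr_ge0 ?besselK_ge0 ?powR_ge0.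
have PE z : 2 `^ (- nu) / (2 * nu + 1) * (x `^ (nu + 1) * besselK (nu + 1) x) * z =
    besselK (nu + 1) x / x `^ nu * (2 `^ (- nu) * x `^ (2 * nu + 1) / (2 * nu + 1) * z).
  rewrite (_ : 2 * nu + 1 = nu + (nu + 1)); last by ring.
  rewrite [x `^ (nu + (nu + 1))]powRD ?(gt_eqF x0) ?implybT//.
  have p0 : x `^ nu != 0 by rewrite gt_eqF// powR_gt0.
  by field; rewrite p0 gt_eqF//; lra.
have /andP[h1 h2] := integral_besselI_bounds _ _ _ nuh b1 b2 x0.
by rewrite E !PE !ler_wpM2l.
Qed.

Theorem theorem3p1 (R : realType) (beta nu : R) :
  -1 < beta -> beta < 1 -> - (1 / 2) < nu ->
  cvg (bessel_expr nu beta y @[y --> 0^'+]) /\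
  (forall x : R, 0 <= x -> bessel_expr0 nu beta x <= 2 / (2 * nu + 1)).
Proof.
move=> b1 b2 nuh; have nu1 : 0 < nu + 1 by lra.
have m0 : 0 < 2 * nu + 1 by lra.
have cv : cvg (bessel_expr nu beta y @[y --> 0^'+]).
  pose P (x : R) := 2 `^ (- nu) / (2 * nu + 1) * (x `^ (nu + 1) * besselK (nu + 1) x).
  pose L : R := 2 `^ (- nu) / (2 * nu + 1) * (bessel_wronskian nu 1 / rgamma (nu + 1)).
  have PL : P x @[x --> 0^'+] --> L.
    by apply: cvgM; [exact: cvg_cst|exact: powR_besselK_is_cvg0].
  apply/cvg_ex; exists (L * rgamma (nu + 1)).
  (* Both bounds have the same limit since the odd part tends to 0. *)
  apply: (@squeeze_cvgr _ _ _ _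
    (fun x => P x * (besselI_even nu x - besselI_odd nu x))
    (fun x => P x * (besselI_even nu x + besselI_odd nu x))).
  - by near=> x; exact: bessel_expr_bounds.
  - rewrite -[rgamma (nu + 1)]subr0; apply: cvgM => //.
    by apply: cvgB; [exact: besselI_even_cvg0|exact: besselI_odd_cvg0].
  - rewrite -[rgamma (nu + 1)]addr0; apply: cvgM => //.
    by apply: cvgD; [exact: besselI_even_cvg0|exact: besselI_odd_cvg0].
have bound x : 0 < x -> bessel_expr nu beta x <= 2 / (2 * nu + 1).
  move=> x0; have /andP[_ h] := bessel_expr_bounds _ _ _ nuh b1 b2 x0.
  apply: (le_trans h); rewrite -mulrA mulrAC ler_pM2r ?invr_gt0//.
  have W := bessel_wronskian_le _ _ nuh x0.
  have /andP[c0 _] := bessel_cross_bounds _ _ nuh x0.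
  have BA := besselI_odd_le_even _ _ nuh x0.
  rewrite bessel_wronskianE in W.
  set Q := x `^ (nu + 1) * besselK (nu + 1) x in W *.
  have Q0 : 0 <= Q by rewrite mulr_ge0 ?powR_ge0 ?besselK_ge0.
  (* Q (A + B) <= 2 Q A, and Q A is at most the Wronskian since the cross term is non-negative. *)
  have h3 : Q * (besselI_even nu x + besselI_odd nu x) <= 2 * 2 `^ nu.
    have := ler_wpM2l Q0 BA; lra.
  rewrite -(ler_pM2l (powR_gt0 nu (ltr0n R 2))) mulrA -powRD ?pnatr_eq0 ?implybT//.
  by rewrite subrr powRr0 mul1r [leRHS]mulrC.
split => // x; rewrite le_eqVlt => /predU1P[<-|x0]; last first.
  by rewrite /bessel_expr0 gt_eqF//; exact: bound.
(* At x = 0 the bound passes to the limit, whose existence is [cv]. *)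
rewrite /bessel_expr0 eqxx; apply: limr_le => //.
by near=> y; exact: bound.
Unshelve. all: by end_near.
Qed.
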